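(* Let $k$ be a non-negative integer and $\Lambda$ a left and right Noetherian ring which is $(k+1)$-Gorenstein. Then the following statements are equivalent. (1) $\mathrm{id}_\Lambda\Lambda\le k$, i.e. the injective dimension of $\Lambda$ as a left $\Lambda$-module is at most $k$. (2) $\mathrm{Fin.dim}\,\Lambda\le k$. (3) $\mathrm{fin.dim}\,\Lambda\le k$. (4) Each module in $\mathrm{mod}\,\Lambda^{op}$ with reduced grade at least $k+1$ is reflexive. (5) Each module in $\mathrm{mod}\,\Lambda^{op}$ with reduced grade at least $k+1$ is torsionless. (6) Each module in $\mathrm{mod}\,\Lambda^{op}$ of $D$-class $k$ is reflexive. (7) A module $N\in\mathrm{mod}\,\Lambda^{op}$ of $D$-class $k$ is projective provided $N^*$ is projective.
   Context: $\mathrm{mod}\,\Lambda$ (resp. $\mathrm{mod}\,\Lambda^{op}$) is the category of finitely generated left (resp. right) $\Lambda$-modules. Let $0\to{}_\Lambda\Lambda\to I'_0\to I'_1\to\cdots$ be a minimal injective resolution of $\Lambda$ as a left module. $\Lambda$ is $n$-Gorenstein if the flat dimension of $I'_i$ is at most $i$ for all $0\le i\le n-1$ (this notion is left-right symmetric). $\mathrm{Fin.dim}\,\Lambda$ is the supremum of the projective dimensions of all left $\Lambda$-modules of finite projective dimension; $\mathrm{fin.dim}\,\Lambda$ is the supremum of the projective dimensions of all finitely generated left $\Lambda$-modules of finite projective dimension. For a positive integer $n$, a module $N\in\mathrm{mod}\,\Lambda^{op}$ has reduced grade at least $n$ if $\mathrm{Ext}^j_{\Lambda^{op}}(N,\Lambda)=0$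 for all $1\le j<n$. Write $(\ )^*=\mathrm{Hom}(\ ,\Lambda)$ and let $\sigma_N:N\to N^{**}$ be the canonical evaluation map. $N$ is torsionless if $\sigma_N$ is a monomorphism, and reflexive if $\sigma_N$ is an isomorphism. $D$-class (for right modules; defined for positive integers): for $X\in\mathrm{mod}\,\Lambda^{op}$ and $Y\in\mathrm{mod}\,\Lambda$, a monomorphism $\rho^*:X^{**}\to Y^*$ is a double dual embedding if it is the dual of an epimorphism $\rho:Y\to X^*$. Any torsionless module in $\mathrm{mod}\,\Lambda^{op}$ is said to be of $D$-class $1$. For an integer $m\ge2$, a torsionless module $T_m\in\mathrm{mod}\,\Lambda^{op}$ is of $D$-class $m$ if there are modules $T_1,\dots,T_{m-1}$ and projective modules $P_1,\dots,P_{m-1}$ in $\mathrm{mod}\,\Lambda^{op}$ and exact sequences $0\to T_i^{**}\to P_i\to T_{i+1}\to0$ for $1\le i\le m-1$ in which each monomorphism $T_i^{**}\to P_i$ is a double dual embedding. *)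

(* Defs.v *)
From HB Require Import structures.
From mathcomp Require Import all_boot all_algebra.
From mathcomp Require Import boolp.

Set Implicit Arguments.
Unset Strict Implicit.
Unset Printing Implicit Defensive.

Import GRing.Theory.
Local Open Scope quotient_scope.
Local Open Scope ring_scope.

(* For a ring R, left R-modules are [lmodType R] and right R-modules are
   [lmodType R^c]: for x in a right module, x.r is written [r *: x], with
   [r : R^c].  Accordingly R^o is R as a left module over itself and R^c^o is R
   as a right module over itself.  [pzRingType] does not exclude the zero
   ring. *)

Section Generalities.
Variable A : pzRingType.
Implicit Types M U V W : lmodType A.

Definition epi (S T : Type) (f : S -> T) : Prop := forall y, exists x, f x = y.

Definition exact_at U V W (f : U -> V) (g : V -> W) : Prop :=
  forall y, g y = 0 <-> exists x, f x = y.

Definition short_exact U V W (f : U -> V) (g : V -> W) : Prop :=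
  [/\ injective f, exact_at f g & epi g].

Definition lin_comb M (s : seq M) (x : M) : Prop :=
  exists c : 'I_(size s) -> A, x = \sum_i c i *: s`_i.

Definition fin_gen M : Prop := exists s : seq M, forall x, lin_comb s x.

Definition left_noetherian : Prop :=
  forall S : {pred A^o}, submod_closed S ->
    exists s : seq A^o, forall x, x \in S <-> lin_comb s x.

Definition projective M : Prop :=
  forall U V (g : {linear U -> V}) (f : {linear M -> V}), epi g ->
    exists h : {linear M -> U}, forall x, g (h x) = f x.

Definition injective_module M : Prop :=
  forall U V (i : {linear U -> V}) (f : {linear U -> M}), injective i ->
    exists h : {linear V -> M}, forall x, h (i x) = f x.

Record resolution M := Resolution {
  res_obj :> nat -> lmodType A;
  res_d : forall i, {linear res_obj i.+1 -> res_obj i};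
  res_aug : {linear res_obj 0 -> M};
  res_aug_epi : epi res_aug;
  res_exact0 : exact_at (res_d 0) res_aug;
  res_exact : forall i, exact_at (res_d i.+1) (res_d i)
}.

Record coresolution M := Coresolution {
  cores_obj :> nat -> lmodType A;
  cores_d : forall i, {linear cores_obj i -> cores_obj i.+1};
  cores_aug : {linear M -> cores_obj 0};
  cores_aug_inj : injective cores_aug;
  cores_exact0 : exact_at cores_aug (cores_d 0);
  cores_exact : forall i, exact_at (cores_d i) (cores_d i.+1)
}.

Definition vanish_above n (X : nat -> lmodType A) : Prop :=
  forall i, (n < i)%N -> forall x : X i, x = 0.

Definition pdim_le n M : Prop :=
  exists P : resolution M, (forall i, projective (P i)) /\ vanish_above n P.

Definition idim_le n M : Prop :=
  exists I : coresolution M,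
    (forall i, injective_module (I i)) /\ vanish_above n I.

Definition essential_range U V (f : U -> V) : Prop :=
  forall S : {pred V}, submod_closed S -> (exists2 v, v \in S & v != 0) ->
    exists u, f u \in S /\ f u != 0.

(* The image of [cores_d I i] is a copy of the i-th cosyzygy, so each term is an
   injective envelope of the corresponding cosyzygy. *)
Definition minimal_injective_resolution M (I : coresolution M) : Prop :=
  [/\ forall i, injective_module (I i), essential_range (cores_aug I)
    & forall i, essential_range (cores_d I i)].

(* Ext^j(M, V) = 0: the cohomology of Hom(P, V) vanishes in degree j, for P a
   projective resolution of M (the choice of P is immaterial). *)
Definition Ext_vanishes (j : nat) M V : Prop :=
  forall P : resolution M, (forall i, projective (P i)) ->
  match j with
  | 0 => forall f : {linear P 0 -> V},
      (forall x, f (res_d P 0 x) = 0) -> forall x, f x = 0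
  | j'.+1 => forall f : {linear P j'.+1 -> V},
      (forall x, f (res_d P j'.+1 x) = 0) ->
      exists g : {linear P j' -> V}, forall x, f x = g (res_d P j' x)
  end.

Definition Findim_le k : Prop :=
  forall M, (exists n, pdim_le n M) -> pdim_le k M.

Definition findim_le k : Prop :=
  forall M, fin_gen M -> (exists n, pdim_le n M) -> pdim_le k M.

End Generalities.

Section Tensor.
Variable R : pzRingType.

Definition balanced (X : lmodType R^c) (F : lmodType R) (G : zmodType)
    (b : X -> F -> G) : Prop :=
  [/\ forall x x' y, b (x + x') y = b x y + b x' y,
      forall x y y', b x (y + y') = b x y + b x y'
    & forall (r : R) x y, b ((r : R^c) *: x) y = b x (r *: y)].

Definition bsum (X F : Type) (G : zmodType) (b : X -> F -> G)
    (s : seq (X * F)) : G := \sum_(p <- s) b p.1 p.2.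

Section Construction.
Variables (X : lmodType R^c) (F : lmodType R).

(* X (x) F as the quotient of the formal sums of pairs by the relation of having
   the same value under every balanced map; see [tensor_universal]. *)
Definition tensor_rel : rel (seq (X * F)) := fun s t =>
  `[< forall (G : zmodType) (b : X -> F -> G),
        balanced b -> bsum b s = bsum b t >].

Lemma tensor_rel_equiv : equiv_class_of tensor_rel.
Proof.
split=> [s|s t|t s u].
- exact/asboolP.
- by apply/asboolP/asboolP => h G b hb; rewrite h.
- by move=> /asboolP h1 /asboolP h2; apply/asboolP => G b hb; rewrite h1 ?h2.
Qed.

Canonical tensor_equiv := EquivRelPack tensor_rel_equiv.

Definition tensor : Type := {eq_quot tensor_rel}.
HB.instance Definition _ := Choice.on tensor.

Definition tensor_of (s : seq (X * F)) : tensor :=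
  \pi_({eq_quot tensor_rel}) s.
Definition tensor_repr (u : tensor) : seq (X * F) :=
  repr (u : {eq_quot tensor_rel}).

Definition tensor_lift (G : zmodType) (b : X -> F -> G) (u : tensor) : G :=
  bsum b (tensor_repr u).

Lemma tensor_reprK u : tensor_of (tensor_repr u) = u.
Proof. exact: reprK. Qed.

Lemma tensor_liftE (G : zmodType) (b : X -> F -> G) s :
  balanced b -> tensor_lift b (tensor_of s) = bsum b s.
Proof.
move=> hb; rewrite /tensor_lift.
have : tensor_rel (tensor_repr (tensor_of s)) s.
  by apply/eqquotP; apply: tensor_reprK.
by move/asboolP; apply.
Qed.

Lemma tensor_ext (u v : tensor) :
  (forall (G : zmodType) (b : X -> F -> G),
     balanced b -> tensor_lift b u = tensor_lift b v) -> u = v.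
Proof.
move=> h; rewrite -(tensor_reprK u) -(tensor_reprK v).
by apply/eqquotP/asboolP.
Qed.

Definition tensor_zero : tensor := tensor_of [::].
Definition tensor_add (u v : tensor) : tensor :=
  tensor_of (tensor_repr u ++ tensor_repr v).
Definition tensor_opp (u : tensor) : tensor :=
  tensor_of [seq (- p.1, p.2) | p <- tensor_repr u].

Lemma balancedNl (G : zmodType) (b : X -> F -> G) x y :
  balanced b -> b (- x) y = - b x y.
Proof.
case=> bD _ _.
have b0 : b 0 y = 0 by apply: (addrI (b 0 y)); rewrite -bD !addr0.
by apply: (addIr (b x y)); rewrite -bD !addNr.
Qed.

Lemma tensor_lift0 (G : zmodType) (b : X -> F -> G) :
  balanced b -> tensor_lift b tensor_zero = 0.
Proof. by move=> hb; rewrite tensor_liftE // /bsum big_nil. Qed.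

Lemma tensor_liftD (G : zmodType) (b : X -> F -> G) u v :
  balanced b ->
  tensor_lift b (tensor_add u v) = tensor_lift b u + tensor_lift b v.
Proof. by move=> hb; rewrite tensor_liftE // /bsum big_cat. Qed.

Lemma tensor_liftN (G : zmodType) (b : X -> F -> G) u :
  balanced b -> tensor_lift b (tensor_opp u) = - tensor_lift b u.
Proof.
move=> hb; rewrite tensor_liftE // /bsum big_map -sumrN.
by apply: eq_bigr => p _ /=; rewrite balancedNl.
Qed.

Lemma tensor_addA : associative tensor_add.
Proof.
by move=> u v w; apply: tensor_ext => G b hb; rewrite !tensor_liftD // addrA.
Qed.

Lemma tensor_addC : commutative tensor_add.
Proof.
by move=> u v; apply: tensor_ext => G b hb; rewrite !tensor_liftD // addrC.
Qed.

Lemma tensor_add0 : left_id tensor_zero tensor_add.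
Proof.
move=> u; apply: tensor_ext => G b hb.
by rewrite tensor_liftD // tensor_lift0 // add0r.
Qed.

Lemma tensor_addN : left_inverse tensor_zero tensor_opp tensor_add.
Proof.
move=> u; apply: tensor_ext => G b hb.
by rewrite tensor_liftD // tensor_liftN // tensor_lift0 // addNr.
Qed.

HB.instance Definition _ := GRing.isZmodule.Build tensor
  tensor_addA tensor_addC tensor_add0 tensor_addN.

Definition tens (x : X) (y : F) : tensor := tensor_of [:: (x, y)].

Lemma tensor_lift_tens (G : zmodType) (b : X -> F -> G) x y :
  balanced b -> tensor_lift b (tens x y) = b x y.
Proof. by move=> hb; rewrite tensor_liftE // /bsum big_seq1. Qed.

Lemma balanced_tens : balanced tens.
Proof.
split=> [x x' y|x y y'|r x y]; apply: tensor_ext => G b hb;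
  rewrite ?tensor_liftD // !tensor_lift_tens //; by case: hb.
Qed.

Lemma tensor_of_sum s : tensor_of s = bsum tens s.
Proof.
rewrite /bsum; elim: s => [|[x y] s IHs]; first by rewrite big_nil.
rewrite big_cons -IHs; apply: tensor_ext => G b hb.
rewrite tensor_liftD // tensor_lift_tens // !tensor_liftE //.
by rewrite /bsum big_cons.
Qed.

Lemma tensor_universal (G : zmodType) (b : X -> F -> G) :
  balanced b ->
  exists! h : tensor -> G, {morph h : u v / u + v} /\
    forall x y, h (tens x y) = b x y.
Proof.
move=> hb; exists (tensor_lift b); split; first split.
- by move=> u v; apply: tensor_liftD.
- by move=> x y; apply: tensor_lift_tens.
move=> h [hD ht]; apply/funext => u.
have h0 : h 0 = 0 by apply: (addrI (h 0)); rewrite -hD !addr0.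
rewrite -(tensor_reprK u) tensor_liftE // tensor_of_sum /bsum.
by rewrite (big_morph h hD h0); apply: eq_bigr => p _; rewrite ht.
Qed.

End Construction.

Definition tensor_map (X Y : lmodType R^c) (F : lmodType R) (f : X -> Y) :
    tensor X F -> tensor Y F := tensor_lift (fun x y => tens (f x) y).

Definition flat (F : lmodType R) : Prop :=
  forall (X Y : lmodType R^c) (f : {linear X -> Y}),
    injective f -> injective (tensor_map (F := F) f).

Definition fdim_le n (M : lmodType R) : Prop :=
  exists P : resolution M, (forall i, flat (P i)) /\ vanish_above n P.

Definition n_gorenstein n : Prop :=
  exists I : coresolution (R^o : lmodType R),
    minimal_injective_resolution I /\
    forall i, (i < n)%N -> fdim_le i (I i).

End Tensor.

Section Hom.
Variables (A : pzRingType) (U V : lmodType A).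

Definition hom : Type := {linear U -> V}.

HB.instance Definition _ := gen_eqMixin hom.
HB.instance Definition _ := gen_choiceMixin hom.

Definition hom_fun (f : hom) : U -> V := (f : {linear U -> V}).

Lemma hom_ext (f g : hom) : hom_fun f =1 hom_fun g -> f = g.
Proof.
case: f g => f [[af] [lf]] [g [[ag] [lg]]]; rewrite /hom_fun /= => /funext fg.
by subst g; rewrite (Prop_irrelevance ag af) (Prop_irrelevance lg lf).
Qed.


Definition hom_zero : hom := (\0 : {linear U -> V}).
Definition hom_opp (f : hom) : hom := (\- (f : {linear U -> V})).
Definition hom_add (f g : hom) : hom :=
  ((f : {linear U -> V}) \+ (g : {linear U -> V})).

Lemma hom_addA : associative hom_add.
Proof. by move=> f g h; apply: hom_ext => x; apply: addrA. Qed.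
Lemma hom_addC : commutative hom_add.
Proof. by move=> f g; apply: hom_ext => x; apply: addrC. Qed.
Lemma hom_add0 : left_id hom_zero hom_add.
Proof. by move=> f; apply: hom_ext => x; apply: add0r. Qed.
Lemma hom_addN : left_inverse hom_zero hom_opp hom_add.
Proof. by move=> f; apply: hom_ext => x; apply: addNr. Qed.

HB.instance Definition _ := GRing.isZmodule.Build hom
  hom_addA hom_addC hom_add0 hom_addN.

Lemma hom_funD (f g : hom) x : hom_fun (f + g) x = hom_fun f x + hom_fun g x.
Proof. by []. Qed.

Lemma hom_funP (f : hom) : linear (hom_fun f).
Proof. exact: linearP. Qed.

Section MkHom.
Variables (f : U -> V) (lf : linear f).
Definition mk_hom_fun : U -> V := f.
HB.instance Definition _ := GRing.isLinear.Build A U V *:%R mk_hom_fun lf.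
Definition mk_hom : hom := (mk_hom_fun : {linear U -> V}).
End MkHom.

End Hom.

Section Duals.
Variable R : pzRingType.

(* M^* for a left module M: a right module under (f.r)(x) = f(x) r. *)
Section LeftDual.
Variable M : lmodType R.

Definition ldual : Type := hom M R^o.
HB.instance Definition _ := GRing.Zmodule.on ldual.

Definition ldual_scale_fun (r : R) (f : ldual) : M -> R^o :=
  fun x => (hom_fun f x : R) * r.

Lemma ldual_scale_linear r f : linear (ldual_scale_fun r f).
Proof.
by move=> a x y; rewrite /ldual_scale_fun hom_funP mulrDl /= -mulrA.
Qed.

Definition ldual_scale (r : R^c) (f : ldual) : ldual :=
  mk_hom (ldual_scale_linear r f).

Lemma ldual_scaleA r s f :
  ldual_scale r (ldual_scale s f) = ldual_scale (r * s) f.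
Proof. by apply: hom_ext => x; apply/esym/mulrA. Qed.
Lemma ldual_scale1 : left_id 1 ldual_scale.
Proof. by move=> f; apply: hom_ext => x; apply: mulr1. Qed.
Lemma ldual_scaleDr : right_distributive ldual_scale +%R.
Proof. by move=> r f g; apply: hom_ext => x; apply: mulrDl. Qed.
Lemma ldual_scaleDl f : {morph ldual_scale^~ f : r s / r + s}.
Proof. by move=> r s; apply: hom_ext => x; apply: mulrDr. Qed.

HB.instance Definition _ := GRing.Zmodule_isLmodule.Build R^c ldual
  ldual_scaleA ldual_scale1 ldual_scaleDr ldual_scaleDl.
End LeftDual.

(* N^* for a right module N: a left module under (r.f)(x) = r f(x). *)
Section RightDual.
Variable N : lmodType R^c.

Definition rdual : Type := hom N R^c^o.
HB.instance Definition _ := GRing.Zmodule.on rdual.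

Definition rdual_scale_fun (r : R) (f : rdual) : N -> R^c^o :=
  fun x => r * (hom_fun f x : R).

Lemma rdual_scale_linear r f : linear (rdual_scale_fun r f).
Proof.
move=> a x y; rewrite /rdual_scale_fun hom_funP.
by rewrite [LHS](mulrDr (r : R)); congr (_ + _); apply: (@mulrA R).
Qed.

Definition rdual_scale (r : R) (f : rdual) : rdual :=
  mk_hom (rdual_scale_linear r f).

Lemma rdual_scaleA r s f :
  rdual_scale r (rdual_scale s f) = rdual_scale (r * s) f.
Proof. by apply: hom_ext => x; apply: (@mulrA R). Qed.
Lemma rdual_scale1 : left_id 1 rdual_scale.
Proof. by move=> f; apply: hom_ext => x; apply: (@mul1r R). Qed.
Lemma rdual_scaleDr : right_distributive rdual_scale +%R.
Proof. by move=> r f g; apply: hom_ext => x; apply: (@mulrDr R). Qed.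
Lemma rdual_scaleDl f : {morph rdual_scale^~ f : r s / r + s}.
Proof. by move=> r s; apply: hom_ext => x; apply: (@mulrDl R). Qed.

HB.instance Definition _ := GRing.Zmodule_isLmodule.Build R rdual
  rdual_scaleA rdual_scale1 rdual_scaleDr rdual_scaleDl.
End RightDual.

(* rho^* : Z^* -> Y^* for a map rho : Y -> Z of left modules. *)
Section DualMap.
Variables (Y Z : lmodType R) (rho : {linear Y -> Z}).

Definition comp_dual_fun (f : ldual Z) : Y -> R^o :=
  fun y => hom_fun f (rho y).

Lemma comp_dual_linear f : linear (comp_dual_fun f).
Proof. by move=> a x y; rewrite /comp_dual_fun linearP hom_funP. Qed.

Definition dual_map (f : ldual Z) : ldual Y := mk_hom (comp_dual_linear f).
End DualMap.

(* sigma_N : N -> N^** for a right module N. *)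
Section Evaluation.
Variable N : lmodType R^c.

Definition eval_fun (x : N) : rdual N -> R^o := fun f => hom_fun f x.

Lemma eval_linear x : linear (eval_fun x).
Proof. by []. Qed.

Definition sigma (x : N) : ldual (rdual N) := mk_hom (eval_linear x).

Lemma sigma_linear : linear sigma.
Proof. by move=> a x y; apply: hom_ext => f; apply: (hom_funP f). Qed.
End Evaluation.

Lemma dual_map_linear (Y Z : lmodType R) (rho : {linear Y -> Z}) :
  linear (dual_map rho).
Proof. by move=> a f g; apply: hom_ext. Qed.

Definition torsionless (N : lmodType R^c) : Prop := injective (@sigma N).
Definition reflexive_module (N : lmodType R^c) : Prop := bijective (@sigma N).

Definition reduced_grade_ge (n : nat) (N : lmodType R^c) : Prop :=
  forall j, (1 <= j < n)%N -> Ext_vanishes j N R^c^o.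

(* A map X^** -> P is a double dual embedding when, up to an identification
   theta of Y^* with P, it is rho^* for an epimorphism rho : Y -> X^*. *)
Definition double_dual_embedding (X P : lmodType R^c)
    (i : ldual (rdual X) -> P) : Prop :=
  exists (Y : lmodType R) (rho : {linear Y -> rdual X})
         (theta : {linear ldual Y -> P}),
    [/\ fin_gen Y, epi rho, bijective theta
      & forall f, i f = theta (dual_map rho f)].

Definition D_step (T T' : lmodType R^c) : Prop :=
  exists (P : lmodType R^c) (i : {linear ldual (rdual T) -> P})
         (p : {linear P -> T'}),
    [/\ fin_gen P, projective P, short_exact i p & double_dual_embedding i].

Fixpoint D_chain (n : nat) (T : lmodType R^c) : Prop :=
  if n is n'.+1 then
    exists T0 : lmodType R^c, [/\ fin_gen T0, D_chain n' T0 & D_step T0 T]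
  else True.

(* For m >= 1 the chain is T_1, ..., T_m = T.  By convention every module is of
   D-class 0. *)
Definition D_class (m : nat) (T : lmodType R^c) : Prop :=
  if m is m'.+1 then torsionless T /\ D_chain m' T else True.

End Duals.

(* Main.v *)
(* Write Ext^j for Ext^j(-, R) and let I be the injective resolution given by the
   Gorenstein hypothesis.  Since Hom(Ext^j(N), I_m) = Tor_j(N, I_m) for N finitely
   generated, the bound on the flat dimension of I_m kills these groups for
   m < j; applied to N / E this gives the key fact ([kernel_grade]): if n <= k,
   Ext^j(N) = 0 for 1 <= j <= n, and E is a submodule of N on which all
   functionals vanish, then Ext^j(E) = 0 for 0 <= j <= n.

   Let P be a resolution of a left module M by finitely generated projectives.
   By induction on j, the key fact shows that C_j = coker(P_j^* -> P_(j+1)^* ) has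
   reduced grade at least j + 1 for j <= k, and the torsion submodule of C_k is
   E = Ext^(k+1)(M).  If C_k is torsionless, then E = 0, whence (5) => (1) by
   Baer's criterion.  In general Ext^j(E) = 0 for 0 <= j <= k, so dualizing a
   resolution of E yields a left module of projective dimension exactly k + 1
   unless E = 0, whence (3) => (1).

   For (1) => (4) and (1) => (6), the coker of N^* -> Q_0^* is a k-th syzygy; for a
   module at the end of a D-chain this holds because each step dualizes to a short
   exact sequence 0 -> T'^* -> P^* -> T^* -> 0, which uses that functionals on T^**
   vanishing on the image of T are zero.  For (7) => (3), the images of the maps
   P_i^* -> P_(i+1)^* form a D-chain.  For (1) => (2), direct sums of injectives
   are injective (Bass), so that all projective modules have injective dimension
   at most k. *)

From HB Require Import structures.
Require Import Defs.
From mathcomp Require Import all_boot all_algebra.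
From mathcomp Require Import boolp classical_sets.

Set Implicit Arguments.
Unset Strict Implicit.
Unset Printing Implicit Defensive.

Import GRing.Theory.
Local Open Scope quotient_scope.
Local Open Scope ring_scope.

(** * Quotients and maps *)

Section Quotient.

(** No Ext or Tor group is ever formed. Vanishing of Ext is exactness of a Hom complex ([ext_zero]).
    For Q finitely generated projective, Hom(Q^*, F) stands in for Q (x) F, which turns a bound on
    flat dimension into exactness of the complexes Hom(Q_i^*, F) ([fdim_exact]). The submodule E is
    not made into a module either: it is represented by a resolution whose augmentation has E as its
    image. The obstacle is that flat dimension is bounded only for I_0, ..., I_k, in a resolution
    that need not stop. No finite dimension of R is available at the start, so vanishing is proved
    degree by degree: Ext^m(-, R) is reached from Hom(-, I_m), for m <= k only. This is why E gets
    grade k + 1 and no more. The two sides match because flatness of the left modules I_m acts on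
    resolutions of right modules, and those arise from left resolutions by transposing. *)

Definition subgroup (V : zmodType) (S : V -> Prop) : Prop :=
  S 0 /\ forall x y, S x -> S y -> S (x - y).

Section ZmodQuotient.
Variables (V : zmodType) (S : V -> Prop) (hS : subgroup S).

Definition zquo_rel : rel V := fun x y => `[< S (x - y) >].

Lemma zquo_rel_equiv : equiv_class_of zquo_rel.
Proof.
have S0 := hS.1; have SB := hS.2.
have SN x : S x -> S (- x) by move=> h; rewrite -[- x]add0r; apply: SB.
split=> [x|x y|y x z].
- by apply/asboolP; rewrite subrr.
- by apply/asboolP/asboolP => /SN; rewrite opprB.
- move=> /asboolP h1 /asboolP h2; apply/asboolP.
  move: (SN _ h2); rewrite opprB => h3.
  by rewrite -(subrK y x) -addrA -[y - z]opprB; apply: SB h1 h3.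
Qed.

Canonical zquo_equiv := EquivRelPack zquo_rel_equiv.

Definition zquo : Type := {eq_quot zquo_rel}.
HB.instance Definition _ := Choice.on zquo.

Definition zpi (x : V) : zquo := \pi_({eq_quot zquo_rel}) x.
Definition zrepr (u : zquo) : V := repr (u : {eq_quot zquo_rel}).

Lemma zreprK u : zpi (zrepr u) = u.
Proof. exact: reprK. Qed.

Lemma zpiP x y : zpi x = zpi y <-> S (x - y).
Proof.
split=> [h|h].
  have : zquo_rel x y by apply/eqquotP; apply: h.
  by move/asboolP.
by apply/eqquotP/asboolP.
Qed.

Definition zquo_add (u v : zquo) : zquo := zpi (zrepr u + zrepr v).
Definition zquo_opp (u : zquo) : zquo := zpi (- zrepr u).

Lemma zreprP x : S (zrepr (zpi x) - x).
Proof. by apply/zpiP; rewrite zreprK. Qed.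

Lemma zquo_addE x y : zquo_add (zpi x) (zpi y) = zpi (x + y).
Proof.
have S0 := hS.1; have SB := hS.2.
have SN z : S z -> S (- z) by move=> h; rewrite -[- z]add0r; apply: SB.
apply/zpiP; rewrite opprD addrACA -[_ - y]opprB.
by apply: SB (zreprP x) _; rewrite -opprB; apply: SN; apply: zreprP.
Qed.

Lemma zquo_oppE x : zquo_opp (zpi x) = zpi (- x).
Proof.
apply/zpiP; rewrite -opprD -[X in S (- X)]opprK opprK.
have S0 := hS.1; have SB := hS.2.
by rewrite -[- _]add0r; apply: SB => //; apply: zreprP.
Qed.

Lemma zquo_addA : associative zquo_add.
Proof.
move=> u v w; rewrite -(zreprK u) -(zreprK v) -(zreprK w).
by rewrite !zquo_addE addrA.
Qed.
Lemma zquo_addC : commutative zquo_add.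
Proof. by move=> u v; rewrite /zquo_add addrC. Qed.
Lemma zquo_add0 : left_id (zpi 0) zquo_add.
Proof. by move=> u; rewrite -(zreprK u) zquo_addE add0r. Qed.
Lemma zquo_addN : left_inverse (zpi 0) zquo_opp zquo_add.
Proof. by move=> u; rewrite -(zreprK u) zquo_oppE zquo_addE addNr. Qed.

HB.instance Definition _ := GRing.isZmodule.Build zquo
  zquo_addA zquo_addC zquo_add0 zquo_addN.

Lemma zpiD x y : zpi (x + y) = zpi x + zpi y.
Proof. by rewrite -zquo_addE. Qed.

Lemma zpi0P x : zpi x = 0 <-> S x.
Proof. by rewrite -{2}[x]subr0; apply: zpiP. Qed.

End ZmodQuotient.

Variable A : pzRingType.

Definition submodule (V : lmodType A) (S : V -> Prop) : Prop :=
  S 0 /\ forall a x y, S x -> S y -> S (a *: x + y).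

Lemma submodule_subgroup (V : lmodType A) (S : V -> Prop) :
  submodule S -> subgroup S.
Proof.
case=> S0 SP; split=> // x y hx hy.
by rewrite -[x - y]addrC -scaleN1r; apply: SP.
Qed.

Section LmodQuotient.
Variables (V : lmodType A) (S : V -> Prop) (hS : submodule S).

Definition lquo : Type := zquo (submodule_subgroup hS).
HB.instance Definition _ := GRing.Zmodule.on lquo.

Definition lquo_pi_fun (x : V) : lquo := zpi (submodule_subgroup hS) x.
Definition lquo_repr (u : lquo) : V := zrepr u.
Definition lquo_scale (a : A) (u : lquo) : lquo := lquo_pi_fun (a *: lquo_repr u).

Lemma lquo_scaleE a x : lquo_scale a (lquo_pi_fun x) = lquo_pi_fun (a *: x).
Proof.
apply/zpiP; rewrite -scalerBr -[_ *: _]addr0.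
by apply: hS.2; [apply: zreprP | apply: hS.1].
Qed.

Lemma lquo_reprK u : lquo_pi_fun (lquo_repr u) = u.
Proof. exact: zreprK. Qed.

Lemma lquo_piD x y : lquo_pi_fun (x + y) = lquo_pi_fun x + lquo_pi_fun y.
Proof. exact: zpiD. Qed.

Lemma lquo_scaleA a b u : lquo_scale a (lquo_scale b u) = lquo_scale (a * b) u.
Proof. by rewrite -(lquo_reprK u) !lquo_scaleE scalerA. Qed.
Lemma lquo_scale1 : left_id 1 lquo_scale.
Proof. by move=> u; rewrite -(lquo_reprK u) lquo_scaleE scale1r. Qed.
Lemma lquo_scaleDr : right_distributive lquo_scale +%R.
Proof.
move=> a u v; rewrite -(lquo_reprK u) -(lquo_reprK v).
by rewrite -lquo_piD !lquo_scaleE -lquo_piD scalerDr.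
Qed.
Lemma lquo_scaleDl u : {morph lquo_scale^~ u : a b / a + b}.
Proof.
by move=> a b; rewrite -(lquo_reprK u) !lquo_scaleE -lquo_piD scalerDl.
Qed.

HB.instance Definition _ := GRing.Zmodule_isLmodule.Build A lquo
  lquo_scaleA lquo_scale1 lquo_scaleDr lquo_scaleDl.

Lemma lquo_pi_linear : linear lquo_pi_fun.
Proof.
move=> a x y; rewrite lquo_piD; congr (_ + _).
by rewrite [RHS]lquo_scaleE.
Qed.

Definition lquo_pi : {linear V -> lquo} := mk_hom lquo_pi_linear.

Lemma lquo_pi0P x : lquo_pi x = 0 <-> S x.
Proof. exact: zpi0P. Qed.

Lemma lquo_pi_epi : epi lquo_pi.
Proof. by move=> u; exists (lquo_repr u); apply: lquo_reprK. Qed.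

End LmodQuotient.
End Quotient.

Arguments lquo_pi_epi {A V S} hS.
Arguments lquo_pi0P {A V S} hS x.

Section Maps.
Variable A : pzRingType.
Implicit Types U V W P Q J K : lmodType A.

Lemma mk_linear U V (f : U -> V) : linear f ->
  exists g : {linear U -> V}, forall x, g x = f x.
Proof. by move=> lf; exists (mk_hom lf). Qed.

(** Lifts and preimages are only known to exist, so maps are given by their graphs; uniqueness makes
    the chosen function linear. *)
Lemma choose_linear U V (R : U -> V -> Prop) :
  (forall x, exists y, R x y) ->
  (forall x y y', R x y -> R x y' -> y = y') ->
  (forall a x x' y y', R x y -> R x' y' -> R (a *: x + x') (a *: y + y')) ->
  exists g : {linear U -> V}, forall x, R x (g x).
Proof.
move=> ex un li; have [f hf] := choice ex.
have lf : linear f by move=> a x y; apply: (un _ _ _ (hf _)); apply: li.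
by exists (mk_hom lf).
Qed.

Lemma ker_submodule U V (f : {linear U -> V}) : submodule (fun x => f x = 0).
Proof.
split=> [|a x y hx hy]; first exact: linear0.
by rewrite linearP hx hy scaler0 addr0.
Qed.

Lemma im_submodule U V (f : {linear U -> V}) :
  submodule (fun y => exists x, f x = y).
Proof.
split=> [|a _ _ [x <-] [y <-]]; first by exists 0; apply: linear0.
by exists (a *: x + y); apply: linearP.
Qed.

Definition coker U V (f : {linear U -> V}) : lmodType A :=
  lquo (im_submodule f).
Definition coker_pi U V (f : {linear U -> V}) : {linear V -> coker f} :=
  lquo_pi (im_submodule f).

Lemma coker_pi_epi U V (f : {linear U -> V}) : epi (coker_pi f).
Proof. exact: lquo_pi_epi. Qed.

Lemma coker_exact U V (f : {linear U -> V}) : exact_at f (coker_pi f).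
Proof. by move=> y; apply: lquo_pi0P. Qed.

Lemma coimage_lift U V W (e : {linear U -> V}) (f : {linear U -> W}) :
  epi e -> (forall x, e x = 0 -> f x = 0) ->
  exists g : {linear V -> W}, forall x, g (e x) = f x.
Proof.
move=> ee hk.
have un x x' : e x = e x' -> f x = f x'.
  move=> h; apply/eqP; rewrite -subr_eq0 -linearB; apply/eqP/hk.
  by rewrite linearB h subrr.
have [g hg] : exists g : {linear V -> W},
    forall y, exists x, e x = y /\ g y = f x.
  apply: (@choose_linear V W (fun y z => exists x, e x = y /\ z = f x)).
  - by move=> y; have [x hx] := ee y; exists (f x), x.
  - by move=> y z z' [x [hx ->]] [x' [hx' ->]]; apply: un; rewrite hx hx'.
  - move=> a _ _ _ _ [x [<- ->]] [x' [<- ->]].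
    by exists (a *: x + x'); rewrite !linearP.
by exists g => x; have [x' [h ->]] := hg (e x); apply: un.
Qed.

Lemma coker_lift U V W (f : {linear U -> V}) (g : {linear V -> W}) :
  (forall x, g (f x) = 0) ->
  exists h : {linear coker f -> W}, forall x, h (coker_pi f x) = g x.
Proof.
move=> h0; apply: coimage_lift; first exact: coker_pi_epi.
by move=> x /coker_exact[y <-].
Qed.

(** [f] need not be onto: [g] factors through U / ker f, a copy of the image of [f], and
    projectivity applies to the quotient map. *)
Lemma projective_lift P U V (f : {linear U -> V}) (g : {linear P -> V}) :
  projective P -> (forall x, exists u, f u = g x) ->
  exists h : {linear P -> U}, forall x, f (h x) = g x.
Proof.
move=> hP hfg.
have kS := ker_submodule f.
have [g' hg'] : exists g' : {linear P -> lquo kS},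
    forall x, exists u, f u = g x /\ g' x = lquo_pi kS u.
  apply: (@choose_linear _ _
    (fun x z => exists u, f u = g x /\ z = lquo_pi kS u)).
  - by move=> x; have [u hu] := hfg x; exists (lquo_pi kS u), u.
  - move=> x _ _ [u [hu ->]] [u' [hu' ->]].
    apply/eqP; rewrite -subr_eq0 -linearB; apply/eqP/lquo_pi0P.
    by rewrite linearB hu hu' subrr.
  - move=> a x x' _ _ [u [hu ->]] [u' [hu' ->]].
    by exists (a *: u + u'); rewrite !linearP hu hu'.
have [h hh] := hP _ _ (lquo_pi kS) g' (lquo_pi_epi kS).
exists h => x; have [u [<- hu]] := hg' x.
have /eqP := hh x; rewrite hu -subr_eq0 -linearB => /eqP/lquo_pi0P/eqP.
by rewrite linearB subr_eq0 => /eqP.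
Qed.

(** Dually, [e] need not be injective: [f] descends to U / ker e, which embeds in [V]. *)
Lemma injective_extend J U V (e : {linear U -> V}) (f : {linear U -> J}) :
  injective_module J -> (forall x, e x = 0 -> f x = 0) ->
  exists g : {linear V -> J}, forall x, g (e x) = f x.
Proof.
move=> hJ hk; pose kS := ker_submodule e.
have piE := lquo_pi0P kS; have pis := lquo_pi_epi kS.
have [e' he'] : exists e' : {linear lquo kS -> V},
    forall x, e' (lquo_pi kS x) = e x.
  by apply: coimage_lift => // x /piE.
have [f' hf'] : exists f' : {linear lquo kS -> J},
    forall x, f' (lquo_pi kS x) = f x.
  by apply: coimage_lift => // x /piE/hk.
have [|g hg] := hJ _ _ e' f'.
  move=> x y; have [u <-] := pis x; have [v <-] := pis y.
  move=> /eqP; rewrite !he' -subr_eq0 -linearB => /eqP/piE.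
  by rewrite linearB => /eqP; rewrite subr_eq0 => /eqP.
by exists g => x; rewrite -he' hg hf'.
Qed.

Lemma linear_ker_inj U V (f : {linear U -> V}) :
  (forall x, f x = 0 -> x = 0) -> injective f.
Proof.
move=> h x y /eqP; rewrite -subr_eq0 -linearB => /eqP/h/eqP.
by rewrite subr_eq0 => /eqP.
Qed.

Lemma inj_lift U V W (i : {linear V -> W}) (f : {linear U -> W}) :
  injective i -> (forall x, exists y, i y = f x) ->
  exists g : {linear U -> V}, forall x, i (g x) = f x.
Proof.
move=> ii hf; apply: (@choose_linear _ _ (fun x y => i y = f x)) => //.
- by move=> x y y' h h'; apply: ii; rewrite h h'.
- by move=> a x x' y y' h h'; rewrite !linearP h h'.
Qed.

Lemma retract_projective P Q (s : {linear P -> Q}) (r : {linear Q -> P}) :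
  (forall x, r (s x) = x) -> projective Q -> projective P.
Proof.
move=> rs hQ U V g f gs; have [h hh] := hQ U V g (f \o r) gs.
by exists (h \o s) => x /=; rewrite hh /= rs.
Qed.

Lemma retract_injective J K (s : {linear J -> K}) (r : {linear K -> J}) :
  (forall x, r (s x) = x) -> injective_module K -> injective_module J.
Proof.
move=> rs hK U V i f ii; have [h hh] := hK U V i (s \o f) ii.
by exists (r \o h) => x /=; rewrite hh /= rs.
Qed.

End Maps.

(** * Noetherian rings and finitely generated projectives *)

Section FinitelyGenerated.
Variable A : pzRingType.
Implicit Types U V W P Q : lmodType A.

Definition rv_comb_fun V n (g : 'I_n -> V) (x : 'rV[A]_n) : V :=
  \sum_i x 0 i *: g i.

Lemma rv_comb_linear V n (g : 'I_n -> V) : linear (rv_comb_fun g).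
Proof.
move=> a x y; rewrite /rv_comb_fun scaler_sumr -big_split.
by apply: eq_bigr => i _; rewrite !mxE scalerDl scalerA.
Qed.

Definition rv_comb V n (g : 'I_n -> V) : {linear 'rV[A]_n -> V} :=
  mk_hom (rv_comb_linear g).

Lemma rv_combE V n (g : 'I_n -> V) x : rv_comb g x = \sum_i x 0 i *: g i.
Proof. by []. Qed.

Lemma rv_lin_sum V n (f : {linear 'rV[A]_n -> V}) x :
  f x = \sum_i x 0 i *: f (delta_mx 0 i).
Proof.
rewrite {1}(row_sum_delta x) linear_sum.
by apply: eq_bigr => i _; rewrite linearZ.
Qed.

Definition fg_sub V (S : V -> Prop) : Prop :=
  exists n (f : {linear 'rV[A]_n -> V}), forall v, S v <-> exists x, f x = v.

Definition noetherian : Prop :=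
  forall S : A^o -> Prop, submodule S -> fg_sub S.

Lemma lin_combP V (s : seq V) v :
  lin_comb s v <-> exists x, rv_comb (fun i : 'I_(size s) => s`_i) x = v.
Proof.
split=> [[c ->]|[x <-]]; last by exists (fun i => x 0 i).
by exists (\row_i c i); rewrite rv_combE; apply: eq_bigr => i _; rewrite mxE.
Qed.

Lemma lin_comb_map V n (f : {linear 'rV[A]_n -> V}) v :
  (exists x, f x = v) ->
  lin_comb [seq f (delta_mx 0 i) | i <- enum 'I_n] v.
Proof.
case=> x <-; exists (fun i => [seq x 0 j | j <- enum 'I_n]`_i).
rewrite rv_lin_sum -(big_mkord xpredT (fun i =>
  [seq x 0 j | j <- enum 'I_n]`_i *:
  [seq f (delta_mx 0 j) | j <- enum 'I_n]`_i)) size_map size_enum_ord big_mkord.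
apply: eq_bigr => i _.
by rewrite !(nth_map i) -?enumT ?size_enum_ord // nth_ord_enum.
Qed.

Lemma left_noetherianP : left_noetherian A -> noetherian.
Proof.
move=> hA S [S0 SP].
have [|s hs] := hA (fun x => `[< S x >]).
  split=> [|a x y /asboolP hx /asboolP hy]; apply/asboolP => //.
  exact: SP.
exists (size s), (rv_comb (fun i : 'I_(size s) => s`_i)) => v.
rewrite -lin_combP -hs; split=> [h|]; [exact/asboolP|by move/asboolP].
Qed.

Lemma fin_genP V : fin_gen V <->
  exists n (f : {linear 'rV[A]_n -> V}), epi f.
Proof.
split=> [[s hs]|[n [f hf]]].
  by exists (size s), (rv_comb (fun i : 'I_(size s) => s`_i)) => v; apply/lin_combP.
by exists [seq f (delta_mx 0 i) | i <- enum 'I_n] => v; apply: lin_comb_map.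
Qed.

Lemma epi_fin_gen V W (f : {linear V -> W}) : epi f -> fin_gen V -> fin_gen W.
Proof.
move=> ef /fin_genP[n [g eg]]; apply/fin_genP; exists n, (f \o g) => w.
by have [v <-] := ef w; have [x <-] := eg v; exists x.
Qed.

Lemma submodule_comb V (S : V -> Prop) n (g : 'I_n -> V) (x : 'rV[A]_n) :
  submodule S -> (forall i, S (g i)) -> S (rv_comb g x).
Proof.
case=> S0 SP hg; rewrite rv_combE.
apply: (big_ind S) => // [u v hu hv|i _].
  by rewrite -[u]scale1r; apply: SP.
by rewrite -[_ *: _]addr0; apply: SP.
Qed.

(** Induction on the number of generators: split off the first one, generate the left ideal of its
    coefficients in elements of [S], and apply the induction hypothesis to the part of [S] in the
    span of the others. *)
Lemma noetherian_sub (hA : noetherian) V n (f : {linear 'rV[A]_n -> V})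
    (S : V -> Prop) :
  submodule S -> (forall v, S v -> exists x, f x = v) -> fg_sub S.
Proof.
elim: n f S => [|n IHn] f S hS hSf.
  exists 0, f => v; split=> [/hSf//|[x <-]].
  by rewrite [x]thinmx0 linear0; apply: hS.1.
have [S0 SP] := hS.
have [f1 f1E] : exists f1 : {linear 'rV[A]_n -> V},
    forall y, f1 y = f (rv_comb (fun i => delta_mx 0 (lift ord0 i)) y).
  by exists (f \o rv_comb (fun i => delta_mx 0 (lift ord0 i))).
pose e := f (delta_mx 0 ord0).
have fE x : exists y, f x = x 0 ord0 *: e + f1 y.
  exists (\row_i x 0 (lift ord0 i)).
  rewrite rv_lin_sum big_ord_recl f1E rv_combE linear_sum.
  congr (_ + _); apply: eq_bigr => i _.  by rewrite linearZ mxE.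
pose I (r : A^o) := exists y, S ((r : A) *: e + f1 y).
have hI : submodule I.
  split; first by exists 0; rewrite scale0r add0r linear0.
  move=> a r s [y hy] [z hz]; exists (a *: y + z).
  have := SP a _ _ hy hz; rewrite linearP scalerDr scalerA.
  by rewrite addrACA -scalerDl.
have [m [g hg]] := hA I hI.
have /choice[y hy] i : I (g (delta_mx 0 i)) by apply/hg; exists (delta_mx 0 i).
pose c i := (g (delta_mx 0 i) : A) *: e + f1 (y i).
have cS x : S (rv_comb c x) by apply: submodule_comb.
have hS' : submodule (fun v => S v /\ exists x, f1 x = v).
  split; first by split=> //; exists 0; rewrite linear0.
  move=> a u v [hu [x hx]] [hv [x' hx']]; split; first exact: SP.
  by exists (a *: x + x'); rewrite linearP hx hx'.
have [p [h hh]] := IHn f1 _ hS' (fun v hv => hv.2).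
exists (m + p)%N.
have [k hk] : exists k : {linear 'rV[A]_(m + p) -> V},
    forall x, k x = rv_comb c (lsubmx x) + h (rsubmx x).
  by apply: mk_linear => a x y0; rewrite !linearP scalerDr addrACA.
exists k => v; split=> [hv|[x <-]]; last first.
  rewrite hk -[rv_comb c _]scale1r; apply: SP => //.
  by have [] := (hh (h (rsubmx x))).2 (ex_intro _ _ erefl).
have [x xv] := hSf _ hv; have [z hz] := fE x.
have [w hw] : exists w, g w = x 0 ord0.
  by apply/hg; exists z; rewrite -hz xv.
(* Subtracting [rv_comb c w] cancels the coefficient of [e] and leaves an element of [S] in the
   range of [f1]. *)
have [t ht] : exists t, h t = v - rv_comb c w.
  apply/hh; split.
    by rewrite addrC -[- rv_comb _ _]scaleN1r; apply: (SP _ _ _ (cS w) hv).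
  exists (z - \sum_i w 0 i *: y i).
  have -> : rv_comb c w = x 0 ord0 *: e + f1 (\sum_i w 0 i *: y i).
    rewrite -hw (rv_lin_sum g) scaler_suml linear_sum -big_split /=.
    rewrite rv_combE; apply: eq_bigr => i _.
    by rewrite /c scalerDr scalerA; congr (_ + _); rewrite linearZ.
  rewrite -xv hz linearB opprD addrACA.
  by rewrite subrr add0r.
by exists (row_mx w t); rewrite hk row_mxKl row_mxKr ht addrC subrK.
Qed.

Lemma noetherian_fin_gen (hA : noetherian) V (S : V -> Prop) :
  fin_gen V -> submodule S -> fg_sub S.
Proof.
by move=> /fin_genP[n [f ef]] hS; apply: (noetherian_sub hA (f := f)).
Qed.

(** A dual basis. In this form duality only exchanges the elements [x] with the functionals
    [phi]. *)
Definition fg_projective P : Prop :=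
  exists n (x : 'I_n -> P) (phi : 'I_n -> {linear P -> A^o}),
    forall p, p = \sum_i (phi i p : A) *: x i.

Lemma rV_fg_projective n : fg_projective 'rV[A]_n.
Proof.
have lc (i : 'I_n) : linear (fun x : 'rV[A]_n => x 0 i : A^o).
  by move=> a x y; rewrite !mxE.
exists n, (fun i => delta_mx 0 i), (fun i => mk_hom (lc i)) => p.
by rewrite {1}(row_sum_delta p).
Qed.

Lemma regular_fg_projective : fg_projective A^o.
Proof.
exists 1%N, (fun=> 1 : A), (fun=> idfun) => p.
by rewrite big_ord1 /GRing.scale /= mulr1.
Qed.

Lemma fg_projectiveP P : fg_projective P -> projective P.
Proof.
case=> n [x [phi hx]] U V g f eg.
have /choice[u hu] i : exists u, g u = f (x i) by apply: eg.
have [h hh] : exists h : {linear P -> U},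
    forall p, h p = \sum_i (phi i p : A) *: u i.
  apply: mk_linear => a p q; rewrite scaler_sumr -big_split.
  by apply: eq_bigr => i _; rewrite linearP scalerDl scalerA.
exists h => p; rewrite hh {2}(hx p) !linear_sum.
by apply: eq_bigr => i _; rewrite !linearZ hu.
Qed.

Lemma fg_projective_fin_gen P : fg_projective P -> fin_gen P.
Proof.
case=> n [x [phi hx]]; apply/fin_genP; exists n, (rv_comb x) => p.
exists (\row_i phi i p); rewrite rv_combE {2}(hx p).
by apply: eq_bigr => i _; rewrite mxE.
Qed.

Lemma retract_fg_projective P Q (s : {linear P -> Q}) (r : {linear Q -> P}) :
  (forall x, r (s x) = x) -> fg_projective Q -> fg_projective P.
Proof.
move=> rs [n [x [phi hx]]].
exists n, (fun i => r (x i)), (fun i => phi i \o s) => p.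
rewrite -{1}(rs p) {1}(hx (s p)) linear_sum.
by apply: eq_bigr => i _; rewrite linearZ.
Qed.

Lemma projective_fg_projective P :
  fin_gen P -> projective P -> fg_projective P.
Proof.
move=> /fin_genP[n [f ef]] hP.
have [s hs] := hP _ _ f (idfun : {linear P -> P}) ef.
exact: retract_fg_projective hs (rV_fg_projective n).
Qed.

Lemma prod_fg_projective P Q :
  fg_projective P -> fg_projective Q -> fg_projective (P * Q)%type.
Proof.
move=> [n [x [phi hx]]] [m [y [psi hy]]].
pose z (i : 'I_(n + m)) : P * Q :=
  match split i with inl j => (x j, 0) | inr j => (0, y j) end.
pose th (i : 'I_(n + m)) : {linear (P * Q)%type -> A^o} :=
  match split i with
  | inl j => phi j \o fst
  | inr j => psi j \o snd
  end.
exists (n + m)%N, z, th => -[p q]; rewrite big_split_ord /=.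
under eq_bigr => i _ do rewrite /z /th (unsplitK (inl i)) /=.
under [X in _ + X]eq_bigr => i _ do rewrite /z /th (unsplitK (inr i)) /=.
have linl (u : P) : (u, 0 : Q) = (fun u => (u, 0)) u by [].
have lL : linear (fun u : P => (u, 0 : Q)).
  by move=> a u v; congr (_, _); rewrite /= scaler0 addr0.
have lR : linear (fun u : Q => (0 : P, u)).
  by move=> a u v; congr (_, _); rewrite /= scaler0 addr0.
have -> : \sum_(i < n) (phi i p : A) *: ((x i, 0) : P * Q) = (p, 0).
  rewrite {2}(hx p) -[RHS]/(mk_hom lL _) linear_sum.
  by apply: eq_bigr => i _; rewrite linearZ.
have -> : \sum_(i < m) (psi i q : A) *: ((0, y i) : P * Q) = (0, q).
  rewrite {2}(hy q) -[RHS]/(mk_hom lR _) linear_sum.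
  by apply: eq_bigr => i _; rewrite linearZ.
by congr (_, _); rewrite /= ?addr0 ?add0r.
Qed.

Lemma fg_projective_sep P (p : P) : fg_projective P ->
  (forall f : {linear P -> A^o}, f p = 0) -> p = 0.
Proof.
case=> n [x [phi hx]] h0; rewrite (hx p).
by apply: big1 => i _; rewrite h0 scale0r.
Qed.

(** [S] stays a predicate on [V]: the augmentation [e] maps into [V] with image [S], and no module
    type is made of [S]. *)
Lemma free_resolution (hA : noetherian) V (S : V -> Prop) :
  fg_sub S ->
  exists (X : nat -> lmodType A) (d : forall i, {linear X i.+1 -> X i})
         (e : {linear X 0 -> V}),
  [/\ forall i, fg_projective (X i), forall v, S v <-> exists x, e x = v,
      exact_at (d 0) e & forall i, exact_at (d i.+1) (d i)].
Proof.
case=> n0 [e he].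
have cover n W (f : {linear 'rV[A]_n -> W}) :
    exists m (g : {linear 'rV[A]_m -> 'rV[A]_n}), exact_at g f.
  have [m [g hg]] := noetherian_sub hA (f := (idfun : {linear 'rV[A]_n -> 'rV[A]_n}))
    (ker_submodule f) (fun v _ => ex_intro _ v erefl).
  by exists m, g.
(* A state is one differential with its two ranks. [step] takes the old source rank as the new
   target rank, so that consecutive differentials match by conversion alone. *)
pose T := {n & {m & {linear 'rV[A]_m -> 'rV[A]_n}}}.
have nxtP (t : T) : exists u : {m & {linear 'rV[A]_m -> 'rV[A]_(projT1 (projT2 t))}},
    exact_at (projT2 u) (projT2 (projT2 t)).
  by have [m [g hg]] := cover _ _ (projT2 (projT2 t)); exists (existT _ m g).
have [m0 [g0 hg0]] := cover _ _ e.
pose step (t : T) : T := existT _ (projT1 (projT2 t)) (sval (cid (nxtP t))).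
pose st i : T := iter i step (existT _ n0 (existT _ m0 g0)).
exists (fun i => 'rV[A]_(projT1 (st i)) : lmodType A),
  (fun i => projT2 (projT2 (st i))), e.
split=> //; first by move=> i; apply: rV_fg_projective.
by move=> i; apply: (svalP (cid (nxtP (st i)))).
Qed.

End FinitelyGenerated.

(** * Projective resolutions and projective dimension *)

Section Resolutions.
Variable A : pzRingType.
Implicit Types U V W M K P Q : lmodType A.

(** For an exact sequence of projectives this is Ext^j(coker (d 0), W) = 0. Without an augmentation
    it also applies to resolutions of submodules that are known only as images. *)
Definition ext_zero (X : nat -> lmodType A) (d : forall i, {linear X i.+1 -> X i})
    (j : nat) W : Prop :=
  match j with
  | 0 => forall f : {linear X 0 -> W},
      (forall x, f (d 0 x) = 0) -> forall x, f x = 0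
  | j'.+1 => forall f : {linear X j'.+1 -> W},
      (forall x, f (d j'.+1 x) = 0) ->
      exists g : {linear X j' -> W}, forall x, f x = g (d j' x)
  end.

Lemma exact_comp0 U V W (f : {linear U -> V}) (g : {linear V -> W}) :
  exact_at f g -> forall x, g (f x) = 0.
Proof. by move=> h x; apply/h; exists x. Qed.

(** The comparison theorem in two adjacent degrees, with a single homotopy component. The last
    equation is the homotopy identity after applying the differential; lifting it gives the next
    component. *)
Lemma resolution_homotopy M (P Q : resolution M) (i : nat) :
  (forall i, projective (P i)) -> (forall i, projective (Q i)) ->
  exists (a : {linear P i -> Q i}) (a1 : {linear P i.+1 -> Q i.+1})
         (b : {linear Q i -> P i}) (b1 : {linear Q i.+1 -> P i.+1})
         (s : {linear Q i -> Q i.+1}),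
  [/\ forall x, a (res_d P i x) = res_d Q i (a1 x),
      forall x, b (res_d Q i x) = res_d P i (b1 x)
    & forall x, res_d Q i (a1 (b1 x) - x - s (res_d Q i x)) = 0].
Proof.
move=> hP hQ; elim: i => [|i [a [a1 [b [b1 [s [ha hb hs]]]]]]].
  have [a ha] := hP 0 _ _ (res_aug Q) (res_aug P) (@res_aug_epi _ _ Q).
  have [b hb] := hQ 0 _ _ (res_aug P) (res_aug Q) (@res_aug_epi _ _ P).
  have [|a1 ha1] := @projective_lift _ _ _ _ (res_d Q 0) (a \o res_d P 0) (hP 1).
    by move=> x; apply/res_exact0; rewrite /= ha; apply/res_exact0; exists x.
  have [|b1 hb1] := @projective_lift _ _ _ _ (res_d P 0) (b \o res_d Q 0) (hQ 1).
    by move=> x; apply/res_exact0; rewrite /= hb; apply/res_exact0; exists x.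
  have [|s hs] := @projective_lift _ _ _ _ (res_d Q 0) ((a \o b) \- idfun) (hQ 0).
    by move=> x; apply/res_exact0; rewrite linearB /= ha hb subrr.
  exists a, a1, b, b1, s; split=> x; rewrite ?ha1 ?hb1 //.
  by rewrite !linearB ha1 hs /= hb1 /= opprB addrA addrNK subrr.
have [|a2 ha2] := @projective_lift _ _ _ _ (res_d Q i.+1) (a1 \o res_d P i.+1) (hP _).
  move=> x; apply/res_exact.
  by rewrite /= -ha (exact_comp0 (@res_exact _ _ P i)) linear0.
have [|b2 hb2] := @projective_lift _ _ _ _ (res_d P i.+1) (b1 \o res_d Q i.+1) (hQ _).
  move=> x; apply/res_exact.
  by rewrite /= -hb (exact_comp0 (@res_exact _ _ Q i)) linear0.
have [|s1 hs1] := @projective_lift _ _ _ _ (res_d Q i.+1)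
    ((a1 \o b1) \- idfun \- (s \o res_d Q i)) (hQ _).
  by move=> x; apply/res_exact; apply: hs.
exists a1, a2, b1, b2, s1; split=> x; rewrite ?ha2 ?hb2 //.
rewrite !linearB ha2 hs1 /= hb2 /= (exact_comp0 (@res_exact _ _ Q i)).
by rewrite linear0 subr0 opprB addrA addrNK subrr.
Qed.

(** The cocycle [f] vanishes on cycles, and modulo cycles a1 b1 is 1 + s d; a primitive [h] of f a1
    on [P] therefore yields the primitive h b - f s on [Q]. *)
Lemma ext_zero_resolution M (P Q : resolution M) W j :
  (forall i, projective (P i)) -> (forall i, projective (Q i)) ->
  ext_zero (res_d P) j.+1 W -> ext_zero (res_d Q) j.+1 W.
Proof.
move=> hP hQ hE f fd.
have [a [a1 [b [b1 [s [ha hb hs]]]]]] := resolution_homotopy j hP hQ.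
have f0 y : res_d Q j y = 0 -> f y = 0.
  by move=> /res_exact[z <-].
have [|h hh] := hE (f \o a1).
  by move=> x; apply: f0; rewrite -ha (exact_comp0 (@res_exact _ _ P j)) linear0.
exists ((h \o b) \- (f \o s)) => x /=.
rewrite hb -hh /=; have /eqP := f0 _ (hs x).
by rewrite !linearB addrAC subr_eq0 => /eqP.
Qed.

Section Cons.
Variables (K P0 M : lmodType A) (i : {linear K -> P0}) (p : {linear P0 -> M}).
Variables (ip : short_exact i p) (R : resolution K).

Definition res_cons_obj (n : nat) : lmodType A :=
  if n is n'.+1 then R n' else P0.

Definition res_cons_d (n : nat) : {linear res_cons_obj n.+1 -> res_cons_obj n} :=
  match n with
  | 0 => i \o res_aug R
  | n'.+1 => res_d R n'
  end.

Lemma res_cons_epi : epi p. Proof. by case: ip. Qed.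

Lemma res_cons_exact0 : exact_at (res_cons_d 0) p.
Proof.
have [_ ex _] := ip => y; split=> [/ex[x <-]|[x <-]].
  by have [z <-] := res_aug_epi R x; exists z.
by apply/ex; exists (res_aug R x).
Qed.

Lemma res_cons_exact n : exact_at (res_cons_d n.+1) (res_cons_d n).
Proof.
case: n => [|n]; last exact: res_exact.
have [ii _ _] := ip => y; split=> [h|[x <-]].
  by apply/(@res_exact0 _ _ R)/ii; rewrite linear0.
by rewrite /= (exact_comp0 (@res_exact0 _ _ R)) linear0.
Qed.

Definition res_cons : resolution M :=
  Resolution res_cons_epi res_cons_exact0 res_cons_exact.
End Cons.

Definition res_shift M (P : resolution M) : resolution (coker (res_d P 1)) :=
  @Resolution _ _ (fun i => P i.+1) (fun i => res_d P i.+1) _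
    (@coker_pi_epi _ _ _ (res_d P 1)) (@coker_exact _ _ _ (res_d P 1))
    (fun i => @res_exact _ _ P i.+1).

Lemma coker_inj U V W (f : {linear U -> V}) (g : {linear V -> W}) :
  exact_at f g ->
  exists2 h : {linear coker f -> W}, injective h
    & forall x, h (coker_pi f x) = g x.
Proof.
move=> ex; have [h hh] := coker_lift (exact_comp0 ex).
exists h => //; apply: linear_ker_inj => u.
have [x <-] := coker_pi_epi u; rewrite hh => /ex hx.
exact/coker_exact.
Qed.

Lemma coker_short_exact U V W (f : {linear U -> V}) (g : {linear V -> W}) :
  exact_at f g ->
  exists2 i : {linear coker f -> W}, short_exact i (coker_pi g)
    & forall x, i (coker_pi f x) = g x.
Proof.
move=> ex; have [i ii hi] := coker_inj ex; exists i => //.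
split=> //; last exact: coker_pi_epi.
move=> y; split=> [/coker_exact[x <-]|[c <-]].
  by exists (coker_pi _ x); apply: hi.
have [x <-] := coker_pi_epi c.
by rewrite hi; apply/coker_exact; exists x.
Qed.

Lemma res_short_exact M (P : resolution M) :
  exists i : {linear coker (res_d P 1) -> P 0}, short_exact i (res_aug P).
Proof.
have [i ii hi] := coker_inj (@res_exact _ _ P 0).
exists i; split=> //; last exact: res_aug_epi.
move=> y; split=> [/res_exact0[x <-]|[u <-]].
  by exists (coker_pi _ x); apply: hi.
have [x <-] := coker_pi_epi u.
by rewrite hi (exact_comp0 (@res_exact0 _ _ P)).
Qed.

Definition zero_mod : lmodType A := 'rV[A]_0.

Lemma zero_modE (x : zero_mod) : x = 0. Proof. exact: thinmx0. Qed.

Lemma zero_mod_fg_projective : fg_projective zero_mod.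
Proof. exact: rV_fg_projective. Qed.

Lemma zero_mod_projective : projective zero_mod.
Proof. exact: fg_projectiveP zero_mod_fg_projective. Qed.

Definition zero_resolution : resolution zero_mod.
Proof.
refine (@Resolution A zero_mod (fun=> zero_mod) (fun=> \0) (\0) _ _ _).
- by move=> y; exists 0; rewrite [y]zero_modE.
- by move=> y; split=> _ //; exists 0; rewrite [y]zero_modE.
- by move=> _ y; split=> _ //; exists 0; rewrite [y]zero_modE.
Defined.

Lemma zero_short_exact M :
  short_exact (\0 : {linear zero_mod -> M}) (idfun : {linear M -> M}).
Proof.
split; first by move=> x y _; rewrite [x]zero_modE [y]zero_modE.
  by move=> y; split=> [h|[x <-] //]; exists 0; apply: esym h.
by move=> y; exists y.
Qed.

Lemma projective_pdim0 M : projective M -> pdim_le 0 M.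
Proof.
move=> hM; exists (res_cons (zero_short_exact M) zero_resolution); split.
  by case=> [|i] //=; apply: zero_mod_projective.
by case=> [|i] //= _ x; apply: zero_modE.
Qed.

Lemma pdim_cons n K P0 M (i : {linear K -> P0}) (p : {linear P0 -> M}) :
  short_exact i p -> projective P0 -> pdim_le n K -> pdim_le n.+1 M.
Proof.
move=> ip hP [R [hR vR]]; exists (res_cons ip R); split.
  by case=> [|j] /=.
by case=> [|j] //= hj; apply: vR.
Qed.

Lemma pdim_le_mono m n M : (m <= n)%N -> pdim_le m M -> pdim_le n M.
Proof.
move=> mn [P [hP vP]]; exists P; split=> // i ni.
by apply: vP; apply: leq_ltn_trans ni.
Qed.

Lemma ext_zero_above n M (P : resolution M) W :
  vanish_above n P -> ext_zero (res_d P) n.+1 W.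
Proof.
move=> vP f _; exists \0 => x /=.
by rewrite (vP n.+1 (ltnSn n) x) linear0.
Qed.

Lemma pdim_ext_zero n M (P : resolution M) W :
  (forall i, projective (P i)) -> pdim_le n M -> ext_zero (res_d P) n.+1 W.
Proof.
move=> hP [Q [hQ vQ]]; apply: ext_zero_resolution hQ hP _.
exact: ext_zero_above.
Qed.

(** The two cokernels are consecutive syzygies. The cocycle tested is the projection of X_(n+1) onto
    coker (d n.+1); a primitive of it retracts X_n onto this submodule and so splits the
    extension. *)
Lemma ext_zero_coker (X : nat -> lmodType A) (d : forall i, {linear X i.+1 -> X i}) n :
  exact_at (d n.+1) (d n) -> projective (X n) ->
  ext_zero d n.+1 (coker (d n.+1)) -> projective (coker (d n)).
Proof.
move=> ex hX hE.
have [g hg] := hE (coker_pi (d n.+1)) (exact_comp0 (@coker_exact _ _ _ _)).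
have [db _ hdb] := coker_inj ex.
have [s hs] : exists s : {linear coker (d n) -> X n},
    forall x, s (coker_pi (d n) x) = x - db (g x).
  apply: (@coker_lift _ _ _ _ (d n) (idfun \- (db \o g))).
  by move=> x /=; rewrite -hg hdb subrr.
apply: (retract_projective (s := s) (r := coker_pi (d n))) hX => u.
have [x <-] := coker_pi_epi u; rewrite hs linearB.
have -> : coker_pi (d n) (db (g x)) = 0; last exact: subr0.
have [y <-] := coker_pi_epi (g x).
by rewrite hdb (exact_comp0 (@coker_exact _ _ _ _)).
Qed.

Lemma pdim_coker n M (P : resolution M) :
  (forall i, projective (P i)) -> pdim_le n M -> projective (coker (res_d P n)).
Proof.
move=> hP hM; apply: ext_zero_coker (hP n) _; first exact: res_exact.
exact: pdim_ext_zero.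
Qed.

Lemma coker_pdim n M (P : resolution M) :
  (forall i, projective (P i)) -> projective (coker (res_d P n)) -> pdim_le n M.
Proof.
elim: n M P => [|n IHn] M P hP hC.
  apply: projective_pdim0.
  have [h hi hh] := coker_inj (@res_exact0 _ _ P).
  have [|g hg] := @inj_lift _ _ _ _ h (idfun : {linear M -> M}) hi.
    by move=> y; have [x <-] := res_aug_epi P y; exists (coker_pi _ x).
  exact: retract_projective hg hC.
have [i hi] := res_short_exact P.
exact: pdim_cons hi (hP 0) (IHn _ (res_shift P) (fun i => hP i.+1) hC).
Qed.

Lemma noetherian_resolution (hA : noetherian A) M : fin_gen M ->
  exists P : resolution M, forall i, fg_projective (P i).
Proof.
move=> fM; have [|X [d [e [hX he h0 hd]]]] := @free_resolution _ hA M (fun=> True).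
  by apply: noetherian_fin_gen => //; split.
have ee : epi e by move=> y; apply/he.
by exists (Resolution ee h0 hd).
Qed.

End Resolutions.

(** * Injective modules and injective dimension *)

Section Injectives.
Variable A : pzRingType.
Implicit Types U V W M J C X K P : lmodType A.

(** Ext^m(coker (d 0), W) can be computed from the injective side, as a subquotient of Hom(coker (d
    0), I_m). The chase runs through the double complex Hom(X_p, I_l), from Hom(X_m, W) to Hom(X_0,
    I_m). *)
Lemma ext_zero_coresolution (X : nat -> lmodType A)
    (d : forall i, {linear X i.+1 -> X i}) W (I : coresolution W) m :
  (forall i, projective (X i)) -> (forall i, exact_at (d i.+1) (d i)) ->
  (forall i, injective_module (I i)) ->
  (forall f : {linear X 0 -> I m}, (forall x, f (d 0 x) = 0) -> forall x, f x = 0) ->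
  ext_zero d m W.
Proof.
move=> hX hd hI h0.
have ddI l := exact_comp0 (@cores_exact _ _ I l).
(* The two cases are one statement, that [g] followed by [cores_d I l] is a coboundary: on X_0 only
   0 is one. *)
have claim p l : (p + l.+1)%N = m -> forall g : {linear X p -> I l},
    (forall x, cores_d I l (g (d p x)) = 0) ->
    match p return {linear X p -> I l} -> Prop with
    | 0 => fun g => forall x, cores_d I l (g x) = 0
    | p'.+1 => fun g => exists h : {linear X p' -> I l},
        forall x, cores_d I l (g x) = cores_d I l (h (d p' x))
    end g.
  elim: p l => [|p IHp] l.
    by rewrite add0n => em; subst m => g hg; apply: (h0 (cores_d I l \o g)).
  rewrite addSnnS => em g hg.
  have [|g' hg'] := @injective_extend _ _ _ _ (d p) (cores_d I l \o g) (hI _).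
    by move=> x /hd[y <-] /=.
  have := IHp _ em g'; case: p IHp em g hg g' hg' => [|p] IHp em g hg g' hg' H.
    have {}H : forall x, cores_d I l.+1 (g' x) = 0.
      by apply: H => x; rewrite hg' /= ddI.
    have [|w hw] := @projective_lift _ _ _ _ (cores_d I l) g' (hX _).
      by move=> x; apply/cores_exact.
    by exists w => x; rewrite hw hg'.
  have [|h hh] := H; first by move=> x; rewrite hg' /= ddI.
  have [w hw] : exists w : {linear X p.+1 -> I l},
      forall x, cores_d I l (w x) = g' x - h (d p x).
    apply: (@projective_lift _ _ _ _ (cores_d I l) (g' \- (h \o d p)) (hX _)).
    by move=> x; apply/cores_exact; rewrite linearB /= hh subrr.
  exists w => x.
  by rewrite hw hg' (exact_comp0 (hd p)) linear0 subr0.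
have augd := exact_comp0 (@cores_exact0 _ _ I).
case: m h0 claim => [|m] h0 claim f fd.
  move=> x; apply: (@cores_aug_inj _ _ I); rewrite linear0.
  by apply: (h0 (cores_aug I \o f)) => y /=; rewrite fd linear0.
have [|g hg] := @injective_extend _ _ _ _ (d m) (cores_aug I \o f) (hI _).
  by move=> x /hd[y <-] /=; rewrite fd linear0.
have := claim m 0 (addn1 _) g.
case: m h0 claim f fd g hg => [|m] h0 claim f fd g hg H.
  have {}H : forall x, cores_d I 0 (g x) = 0.
    by apply: H => x; rewrite hg /= augd.
  have [|h hh] := @inj_lift _ _ _ _ (cores_aug I) g (@cores_aug_inj _ _ I).
    by move=> x; apply/cores_exact0.
  by exists h => x; apply: (@cores_aug_inj _ _ I); rewrite hh hg.
have [|h hh] := H; first by move=> x; rewrite hg /= augd.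
have [w hw] : exists w : {linear X m.+1 -> W},
    forall x, cores_aug I (w x) = g x - h (d m x).
  apply: (@inj_lift _ _ _ _ (cores_aug I) (g \- (h \o d m)) (@cores_aug_inj _ _ I)).
  by move=> x; apply/cores_exact0; rewrite linearB /= hh subrr.
exists w => x; apply: (@cores_aug_inj _ _ I).
by rewrite hw hg (exact_comp0 (hd m)) linear0 subr0.
Qed.

(** [f] is a plain function, linear on [S] only, so that the left ideal [S] need not be made into a
    module. *)
Lemma baer M :
  (forall (S : A^o -> Prop) (f : A^o -> M), submodule S ->
     (forall a x y, S x -> S y -> f (a *: x + y) = a *: f x + f y) ->
     exists m, forall s, S s -> f s = (s : A) *: m) ->
  injective_module M.
Proof.
move=> hM U V i f ii.
pose Q (G : set (V * M)%type) := [/\ submodule (G : (V * M)%type -> Prop),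
  forall m, G (0, m) -> m = 0 & forall u, G (i u, f u)].
have [|G [PG mG]] := @Zorn_bigcup (V * M)%type (fun G => G = set0 \/ Q G).
- move=> F FP Ftot.
  have [[G0 [FG0 QG0]]|nQ] := pselect (exists G, F G /\ Q G); last first.
    left; rewrite predeqE => z; split=> // -[G FG Gz].
    have [G0|QG] := FP _ FG; first by move: Gz; rewrite G0.
    by case: nQ; exists G.
  have FQ G z : F G -> G z -> Q G.
    by move=> FG Gz; have [G0E|//] := FP _ FG; move: Gz; rewrite G0E.
  right; have [[S0 SP] hf hi] := QG0; split.
  + split; first by exists G0.
    move=> a x y [G FG Gx] [H FH Hy].
    have [GH|HG] := Ftot _ _ FG FH.
      by exists H => //; have [[_ hP] _ _] := FQ _ _ FH Hy; apply: hP => //; apply: GH.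
    by exists G => //; have [[_ hP] _ _] := FQ _ _ FG Gx; apply: hP => //; apply: HG.
  + by move=> m [G FG Gm]; have [_ h _] := FQ _ _ FG Gm; apply: h.
  + by move=> u; exists G0.
have {PG} QG : Q G.
  case: PG => // G0; pose G1 : set (V * M)%type := fun z => exists u, z = (i u, f u).
  exfalso; apply: (mG G1).
    rewrite G0; split=> // /(_ (i 0, f 0)).
    by apply; exists 0.
  right; split.
  - split; first by exists 0; rewrite !linear0.
    by move=> a _ _ [u ->] [v ->]; exists (a *: u + v); rewrite !linearP.
  - move=> m [u [hu ->]]; suff -> : u = 0 by rewrite linear0.
    by apply: ii; rewrite -hu linear0.
  - by move=> u; exists u.
have [[G0 GP] Gf Gi] := QG.
have GP2 a x y x' y' : G (x, y) -> G (x', y') -> G (a *: x + x', a *: y + y').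
  by move=> h h'; apply: (GP a _ _ h h').
have Gu v m m' : G (v, m) -> G (v, m') -> m = m'.
  move=> h h'; apply/eqP; rewrite -subr_eq0; apply/eqP/Gf.
  by have := GP2 (-1) _ _ _ _ h' h; rewrite !scaleN1r addNr addrC.
have Gtot v : exists m, G (v, m).
  (* The scalars that carry [v] into the domain of the maximal graph form the ideal on which the
     hypothesis is used. *)
  pose S (r : A^o) := exists m, G ((r : A) *: v, m).
  have /choice[g hg] r : exists m, S r -> G ((r : A) *: v, m).
    by have [[m hm]|h] := pselect (S r); [exists m|exists 0].
  have hS : submodule S.
    split; first by exists 0; rewrite scale0r.
    move=> a r s [m hm] [m' hm']; exists (a *: m + m').
    by rewrite scalerDl -scalerA; apply: GP2.
  have [|m hm] := hM S g hS.
    move=> a x y hx hy; apply: (Gu _ _ _ (hg _ _)); first exact: hS.2.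
    by rewrite scalerDl -scalerA; apply: GP2; apply: hg.
  apply: contrapT => nm.
  pose G1 : set (V * M)%type := fun z =>
    exists x y (r : A), G (x, y) /\ z = (x + r *: v, y + r *: m).
  apply: (mG G1).
    split; last first.
      move=> h; apply: nm; exists m; apply: h.
      by exists 0, 0, 1; rewrite !add0r !scale1r.
    by move=> [x y] h; exists x, y, 0; rewrite !scale0r !addr0.
  right; split.
  - split; first by exists 0, 0, 0; rewrite !scale0r !addr0.
    move=> a _ _ [x [y [r [h ->]]]] [x' [y' [r' [h' ->]]]].
    exists (a *: x + x'), (a *: y + y'), (a * r + r'); split; first exact: GP2.
    by congr (_, _); rewrite /= scalerDr scalerDl scalerA addrACA.
  - move=> m' [x [y [r [h [hx ->]]]]].
    have ex : x = - r *: v by apply/eqP; rewrite scaleNr -addr_eq0 -hx.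
    rewrite ex in h; have Sr : S (- r) by exists y.
    by rewrite (Gu _ _ _ h (hg _ Sr)) (hm _ Sr) scaleNr addNr.
  - by move=> u; exists (i u), (f u), 0; rewrite !scale0r !addr0.
have [h hh] : exists h : {linear V -> M}, forall v, G (v, h v).
  by apply: choose_linear Gtot Gu _ => a x x' y y'; apply: GP2.
by exists h => u; apply: Gu (hh _) (Gi u).
Qed.

Section Cocons.
Variables (M J C : lmodType A) (i : {linear M -> J}) (p : {linear J -> C}).
Variables (ip : short_exact i p) (I : coresolution C).

Definition cores_cons_obj (n : nat) : lmodType A :=
  if n is n'.+1 then I n' else J.

Definition cores_cons_d (n : nat) :
    {linear cores_cons_obj n -> cores_cons_obj n.+1} :=
  match n with
  | 0 => cores_aug I \o p
  | n'.+1 => cores_d I n'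
  end.

Lemma cores_cons_inj : injective i. Proof. by case: ip. Qed.

Lemma cores_cons_exact0 : exact_at i (cores_cons_d 0).
Proof.
have [_ ex _] := ip => y; split=> [h|[x <-]].
  by apply/ex/(@cores_aug_inj _ _ I); rewrite linear0.
by rewrite /= (exact_comp0 ex) linear0.
Qed.

Lemma cores_cons_exact n : exact_at (cores_cons_d n) (cores_cons_d n.+1).
Proof.
case: n => [|n]; last exact: cores_exact.
have [_ _ ep] := ip => y; split=> [/cores_exact0[x <-]|[x <-]].
  by have [z <-] := ep x; exists z.
by apply/cores_exact0; exists (p x).
Qed.

Definition cores_cons : coresolution M :=
  Coresolution cores_cons_inj cores_cons_exact0 cores_cons_exact.
End Cocons.

Section Coshift.
Variables (M : lmodType A) (I : coresolution M).

Definition cores_shift_aug : {linear coker (cores_aug I) -> I 1} :=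
  s2val (cid2 (coker_inj (@cores_exact0 _ _ I))).

Lemma cores_shift_inj : injective cores_shift_aug.
Proof. exact: (s2valP (cid2 (coker_inj (@cores_exact0 _ _ I)))). Qed.

Lemma cores_shift_augE x : cores_shift_aug (coker_pi _ x) = cores_d I 0 x.
Proof. exact: (s2valP' (cid2 (coker_inj (@cores_exact0 _ _ I)))). Qed.

Lemma cores_shift_exact0 : exact_at cores_shift_aug (cores_d I 1).
Proof.
move=> y; split=> [/cores_exact[x <-]|[u <-]].
  by exists (coker_pi _ x); apply: cores_shift_augE.
have [x <-] := coker_pi_epi u.
by rewrite cores_shift_augE (exact_comp0 (@cores_exact _ _ I 0)).
Qed.

Definition cores_shift : coresolution (coker (cores_aug I)) :=
  @Coresolution _ _ (fun i => I i.+1) (fun i => cores_d I i.+1) _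
    cores_shift_inj cores_shift_exact0 (fun i => @cores_exact _ _ I i.+1).

Lemma cores_short_exact : short_exact (cores_aug I) (coker_pi (cores_aug I)).
Proof.
split; [exact: cores_aug_inj | exact: coker_exact | exact: coker_pi_epi].
Qed.
End Coshift.

Definition zero_coresolution : coresolution (zero_mod A).
Proof.
refine (@Coresolution A (zero_mod A) (fun=> zero_mod A) (fun=> \0) (\0) _ _ _).
- by move=> x y _; rewrite [x]zero_modE [y]zero_modE.
- by move=> y; split=> _ //; exists 0; rewrite [y]zero_modE.
- by move=> _ y; split=> _ //; exists 0; rewrite [y]zero_modE.
Defined.

Lemma zero_mod_injective : injective_module (zero_mod A).
Proof. by move=> U V i f _; exists \0 => x; rewrite [f x]zero_modE. Qed.

Lemma injective_idim0 M : injective_module M -> idim_le 0 M.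
Proof.
move=> hM.
have ip : short_exact (idfun : {linear M -> M}) (\0 : {linear M -> zero_mod A}).
  split=> //; last by move=> y; exists 0; rewrite [y]zero_modE.
  by move=> y; split=> // _; exists y.
exists (cores_cons ip zero_coresolution); split.
  by case=> [|i] //=; apply: zero_mod_injective.
by case=> [|i] //= _ x; apply: zero_modE.
Qed.

Lemma idim_cons n M J C (i : {linear M -> J}) (p : {linear J -> C}) :
  short_exact i p -> injective_module J -> idim_le n C -> idim_le n.+1 M.
Proof.
move=> ip hJ [I [hI vI]]; exists (cores_cons ip I); split.
  by case=> [|j] /=.
by case=> [|j] //= hj; apply: vI.
Qed.

Lemma idim0_injective M : idim_le 0 M -> injective_module M.
Proof.
case=> I [hI vI].
have [|r hr] := @inj_lift _ _ _ _ (cores_aug I) (idfun : {linear I 0 -> I 0})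
    (@cores_aug_inj _ _ I).
  by move=> x; apply/cores_exact0; apply: vI.
apply: (retract_injective (s := cores_aug I) (r := r)) (hI 0) => x.
by apply: (@cores_aug_inj _ _ I); rewrite hr.
Qed.

Lemma idim_uncons n M : idim_le n.+1 M ->
  exists J C (i : {linear M -> J}) (p : {linear J -> C}),
    [/\ short_exact i p, injective_module J & idim_le n C].
Proof.
case=> I [hI vI]; exists (I 0), _, (cores_aug I), (coker_pi (cores_aug I)).
split; first exact: cores_short_exact.
  exact: hI.
by exists (cores_shift I); split=> [i|i ni]; [apply: hI|apply: vI].
Qed.

Fixpoint syzygy n C : Prop :=
  if n is n'.+1 then
    exists P C' (i : {linear C -> P}) (p : {linear P -> C'}),
      [/\ short_exact i p, projective P & syzygy n' C']
  else True.

Lemma syzygyW n C : syzygy n.+1 C -> syzygy n C.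
Proof.
elim: n C => [|n IHn] C //; case=> P [C' [i [p [ip hP hC']]]].
by exists P, C', i, p; split=> //; apply: IHn.
Qed.

(** Ext^1(C, W) is Ext^(k+1)(-, W) of the module whose k-th syzygy is [C]. Each step trades one
    cosyzygy of [W] for one embedding of [C] into a projective. *)
Lemma idim_syzygy_extend k W K P C (i : {linear K -> P}) (p : {linear P -> C})
    (f : {linear K -> W}) :
  idim_le k W -> short_exact i p -> syzygy k C ->
  exists g : {linear P -> W}, forall x, g (i x) = f x.
Proof.
elim: k W K P C i p f => [|k IHk] W K P C i p f.
  by move=> /idim0_injective hW [ii _ _] _; apply: hW.
move=> /idim_uncons[J [D [a [b [ab hJ hD]]]]] ip [P' [C' [j [q [jq hP' hC']]]]].
have [ii ex ep] := ip; have [ai exa eb] := ab.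
have [u hu] := hJ _ _ i (a \o f) ii.
have [|v hv] := @coimage_lift _ _ _ _ p (b \o u) ep.
  by move=> x /ex[y <-] /=; rewrite hu (exact_comp0 exa).
have [w hw] := IHk _ _ _ _ _ _ v hD jq hC'.
have [t ht] := hP' _ _ b w eb.
have [g hg] : exists g : {linear P -> W}, forall x, a (g x) = u x - t (j (p x)).
  apply: (@inj_lift _ _ _ _ a (u \- (t \o j \o p)) ai).
  by move=> x; apply/exa; rewrite linearB /= ht hw hv subrr.
exists g => x; apply: ai; rewrite hg hu (exact_comp0 ex).
by rewrite !linear0 addr0.
Qed.
End Injectives.

(** * Injective dimension detected by Ext of cyclic modules *)

Section InjectiveDimension.
Variable A : pzRingType.
Implicit Types U V W M : lmodType A.

Section ComplexCons.
Variables (X0 : lmodType A) (X : nat -> lmodType A) (e : {linear X 0 -> X0})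
  (d : forall i, {linear X i.+1 -> X i}).

Definition ccons (n : nat) : lmodType A := if n is n'.+1 then X n' else X0.

Definition ccons_d (n : nat) : {linear ccons n.+1 -> ccons n} :=
  match n with 0 => e | n'.+1 => d n' end.

Lemma ccons_exact : exact_at (d 0) e -> (forall i, exact_at (d i.+1) (d i)) ->
  forall i, exact_at (ccons_d i.+1) (ccons_d i).
Proof. by move=> h0 h [|i]; [apply: h0 | apply: h]. Qed.

Lemma ccons_all (T : lmodType A -> Prop) :
  T X0 -> (forall i, T (X i)) -> forall i, T (ccons i).
Proof. by move=> h0 h [|i]; [apply: h0 | apply: h]. Qed.
End ComplexCons.

(** The kernel of [cores_d I l] is the l-th cosyzygy of [W], so this is the vanishing of Ext^(m+1)
    into that cosyzygy, which dimension shifting identifies with Ext^(k+1) into [W]. *)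
Lemma cosyzygy_coboundary (X : nat -> lmodType A)
    (d : forall i, {linear X i.+1 -> X i}) W (I : coresolution W) k l m :
  (forall i, projective (X i)) -> (forall i, exact_at (d i.+1) (d i)) ->
  (forall i, injective_module (I i)) -> ext_zero d k.+1 W ->
  (m + l)%N = k -> forall g : {linear X m.+1 -> I l},
  (forall x, cores_d I l (g x) = 0) -> (forall x, g (d m.+1 x) = 0) ->
  exists h : {linear X m -> I l},
    (forall x, cores_d I l (h x) = 0) /\ forall x, g x = h (d m x).
Proof.
move=> hX hd hI hE.
elim: l m => [|l IHl] m ml g cg gd.
  move: ml; rewrite addn0 => mk; subst m.
  have [|f hf] := @inj_lift _ _ _ _ (cores_aug I) g (@cores_aug_inj _ _ I).
    by move=> x; apply/cores_exact0.
  have [|h hh] := hE f.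
    by move=> x; apply: (@cores_aug_inj _ _ I); rewrite hf gd linear0.
  exists (cores_aug I \o h); split=> x /=.
    by rewrite (exact_comp0 (@cores_exact0 _ _ I)).
  by rewrite -hh hf.
have [|g' hg'] := @projective_lift _ _ _ _ (cores_d I l) g (hX _).
  by move=> x; apply/cores_exact.
have [||| h' [ch' hh']] := IHl m.+1 _ (g' \o d m.+1).
- by rewrite addSnnS.
- by move=> x /=; rewrite hg' gd.
- by move=> x /=; rewrite (exact_comp0 (hd _)) linear0.
have [h hh] : exists h : {linear X m -> I l}, forall x, h (d m x) = g' x - h' x.
  apply: (@injective_extend _ _ _ _ (d m) (g' \- h') (hI _)).
  by move=> x /hd[y <-]; rewrite /= -hh' /= subrr.
exists (cores_d I l \o h); split=> x /=.
  by rewrite (exact_comp0 (@cores_exact _ _ I l)).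
by rewrite hh linearB hg' ch' subr0.
Qed.

Lemma idim_of_ext (hA : noetherian A) W (I : coresolution W) k :
  (forall i, injective_module (I i)) ->
  (forall (X : nat -> lmodType A) (d : forall i, {linear X i.+1 -> X i}),
     (forall i, fg_projective (X i)) -> (forall i, exact_at (d i.+1) (d i)) ->
     ext_zero d k.+1 W) ->
  idim_le k W.
Proof.
move=> hI hE.
(* Baer's condition for the k-th cosyzygy. In this form it passes unchanged to [cores_shift I],
   which drives the induction on k. *)
have {hE} bI : forall (S : A^o -> Prop) (f : A^o -> I k), submodule S ->
    (forall a x y, S x -> S y -> f (a *: x + y) = a *: f x + f y) ->
    (forall s, S s -> cores_d I k (f s) = 0) ->
    exists m, cores_d I k m = 0 /\ forall s, S s -> f s = (s : A) *: m.
  move=> S f hS fP fc.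
  have [X [d [e [fX he h0 hd]]]] := free_resolution hA (hA S hS).
  have eS x : S (e x) by apply/he; exists x.
  have [g hg] : exists g : {linear X 0 -> I k}, forall x, g x = f (e x).
    by apply: mk_linear => a x y; rewrite linearP; apply: fP.
  (* Prepending A to the resolution of [S] gives one of A / S, in which [g] sits in degree 1. *)
  have fT : forall i, fg_projective (ccons A^o X i).
    by apply: ccons_all => //; apply: regular_fg_projective.
  have hT := ccons_exact h0 hd.
  have [||h [ch hh]] := @cosyzygy_coboundary _ (ccons_d e d) W I k k 0
     (fun i => fg_projectiveP (fT i)) hT hI (hE _ _ fT hT) erefl g.
  - by move=> x; rewrite hg; apply: fc.
  - by move=> x; rewrite hg /= (exact_comp0 h0) -(linear0 e) -hg linear0.
  exists (h (1 : A)); split=> // s /he[x <-].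
  by rewrite -hg hh -linearZ; congr (h _); rewrite /GRing.scale /= mulr1.
elim: k W I hI bI => [|k IHk] W I hI bI.
  apply/injective_idim0/baer => S f hS fP.
  have [||m [/cores_exact0[w hw] hm]] := bI S (cores_aug I \o f) hS.
  - by move=> a x y hx hy; rewrite /= fP // linearP.
  - by move=> s _; rewrite /= (exact_comp0 (@cores_exact0 _ _ I)).
  exists w => s hs; apply: (@cores_aug_inj _ _ I).
  by rewrite linearZ_LR hw -hm.
apply: idim_cons (cores_short_exact I) (hI 0) _.
by apply: (IHk _ (cores_shift I)) => [i|]; [apply: hI|apply: bI].
Qed.

End InjectiveDimension.

(** * Direct sums *)

Section DirectSum.
Variable A : pzRingType.
Implicit Types U V W M P : lmodType A.
Variable S : choiceType.

Definition finite_support V (f : S -> V) : Prop :=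
  exists s : seq S, forall x, x \notin s -> f x = 0.

Section DsumModule.
Variable V : lmodType A.

Record dsum : Type := Dsum { dsum_fun :> S -> V; _ : finite_support dsum_fun }.

Lemma dsum_finite (f : dsum) : finite_support f. Proof. by case: f. Qed.

Lemma dsum_ext (f g : dsum) : f =1 g -> f = g.
Proof.
case: f g => f hf [g hg] /= /funext fg; subst g.
by rewrite (Prop_irrelevance hf hg).
Qed.

HB.instance Definition _ := gen_eqMixin dsum.
HB.instance Definition _ := gen_choiceMixin dsum.

Lemma finite_support_lin a (f g : dsum) : finite_support (fun x => a *: f x + g x).
Proof.
have [s hs] := dsum_finite f; have [t ht] := dsum_finite g.
exists (s ++ t) => x; rewrite mem_cat negb_or => /andP[xs xt].
by rewrite hs // ht // scaler0 addr0.
Qed.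

Lemma finite_support0 : finite_support (fun=> 0 : V).
Proof. by exists [::]. Qed.

Definition dsum_zero := Dsum finite_support0.
(** Sum, scaling and opposite are all instances, so that finiteness of supports is checked once. *)
Definition dsum_lin a (f g : dsum) := Dsum (finite_support_lin a f g).
Definition dsum_add (f g : dsum) := dsum_lin 1 f g.
Definition dsum_scale a (f : dsum) := dsum_lin a f dsum_zero.
Definition dsum_opp (f : dsum) := dsum_scale (-1) f.

Lemma dsum_addA : associative dsum_add.
Proof. by move=> f g h; apply: dsum_ext => x /=; rewrite !scale1r addrA. Qed.
Lemma dsum_addC : commutative dsum_add.
Proof. by move=> f g; apply: dsum_ext => x /=; rewrite !scale1r addrC. Qed.
Lemma dsum_add0 : left_id dsum_zero dsum_add.
Proof. by move=> f; apply: dsum_ext => x /=; rewrite !scale1r add0r. Qed.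
Lemma dsum_addN : left_inverse dsum_zero dsum_opp dsum_add.
Proof.
by move=> f; apply: dsum_ext => x /=; rewrite scaleN1r scale1r addr0 addNr.
Qed.

HB.instance Definition _ := GRing.isZmodule.Build dsum
  dsum_addA dsum_addC dsum_add0 dsum_addN.

Lemma dsum_scaleA a b f : dsum_scale a (dsum_scale b f) = dsum_scale (a * b) f.
Proof. by apply: dsum_ext => x /=; rewrite !addr0 scalerA. Qed.
Lemma dsum_scale1 : left_id 1 dsum_scale.
Proof. by move=> f; apply: dsum_ext => x /=; rewrite scale1r addr0. Qed.
Lemma dsum_scaleDr : right_distributive dsum_scale +%R.
Proof.
by move=> a f g; apply: dsum_ext => x /=; rewrite !scale1r !addr0 scalerDr.
Qed.
Lemma dsum_scaleDl f : {morph dsum_scale^~ f : a b / a + b}.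
Proof.
by move=> a b; apply: dsum_ext => x /=; rewrite !scale1r !addr0 scalerDl.
Qed.

HB.instance Definition _ := GRing.Zmodule_isLmodule.Build A dsum
  dsum_scaleA dsum_scale1 dsum_scaleDr dsum_scaleDl.

Lemma dsumE a (f g : dsum) x : (a *: f + g) x = a *: f x + g x.
Proof. by rewrite /= scale1r addr0. Qed.

Lemma dsum_proj_linear x : linear (fun f : dsum => f x).
Proof. by move=> a f g; apply: dsumE. Qed.

Definition dsum_proj x : {linear dsum -> V} := mk_hom (dsum_proj_linear x).
End DsumModule.

Lemma finite_support_map V W (h : {linear V -> W}) (f : dsum V) :
  finite_support (h \o f).
Proof.
by have [s hs] := dsum_finite f; exists s => x /hs /= ->; apply: linear0.
Qed.

Definition dsum_map_fun V W (h : {linear V -> W}) (f : dsum V) : dsum W :=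
  Dsum (finite_support_map h f).

Lemma dsum_map_linear V W (h : {linear V -> W}) : linear (dsum_map_fun h).
Proof.
by move=> a f g; apply: dsum_ext => x; rewrite /= scale1r !addr0 linearP !scale1r.
Qed.

Definition dsum_map V W (h : {linear V -> W}) : {linear dsum V -> dsum W} :=
  mk_hom (dsum_map_linear h).

Lemma dsum_map_exact U V W (f : {linear U -> V}) (g : {linear V -> W}) :
  exact_at f g -> exact_at (dsum_map f) (dsum_map g).
Proof.
move=> ex v; split=> [h|[u <-]]; last first.
  by apply: dsum_ext => x; apply: (exact_comp0 ex).
have h0 x : g (v x) = 0 by move/(congr1 (fun k : dsum W => k x)): h.
(* Over 0 the preimage 0 is prescribed, which keeps the support of the choice finite. *)
have /choice[u hu] x : exists u, f u = v x /\ (v x = 0 -> u = 0).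
  have [->|nz] := pselect (v x = 0); first by exists 0; rewrite linear0.
  by have [u hu] := (ex (v x)).1 (h0 x); exists u.
have fu : finite_support u.
  by have [s hs] := dsum_finite v; exists s => x /hs; apply: (hu x).2.
by exists (Dsum fu); apply: dsum_ext => x; apply: (hu x).1.
Qed.

Lemma dsum_map_inj V W (h : {linear V -> W}) : injective h -> injective (dsum_map h).
Proof.
move=> hi f g e; apply: dsum_ext => x; apply: hi.
by move/(congr1 (fun k : dsum W => k x)): e.
Qed.

(* Over a noetherian ring, a map from a left ideal to a direct sum has its image
   in a finite subsum, so that it can be extended componentwise. *)
Lemma dsum_injective (hA : noetherian A) J :
  injective_module J -> injective_module (dsum J).
Proof.
move=> hJ; apply: baer => I f hI fP.
have [n [e he]] := hA I hI.
have eI x : I (e x) by apply/he; exists x.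
have [g hg] : exists g : {linear 'rV[A]_n -> dsum J}, forall x, g x = f (e x).
  by apply: mk_linear => a x y; rewrite linearP; apply: fP.
have [s hs] : exists s : seq S, forall w x, x \notin s -> g w x = 0.
  have /choice[t ht] i := dsum_finite (g (delta_mx 0 i)).
  exists (flatten [seq t i | i <- enum 'I_n]) => w x xs.
  rewrite -[g w x]/(dsum_proj J x (g w)) rv_lin_sum linear_sum big1 // => i _.
  rewrite linearZ -[dsum_proj _ _ _]/(g _ x) ht; first exact: scaler0.
  apply: (contra _ xs) => xt; apply/flattenP; exists (t i) => //.
  by apply: map_f; rewrite mem_enum.
have /choice[m hm] x : exists m : J, (x \notin s -> m = 0) /\
    forall w, g w x = (e w : A) *: m.
  have [xs|xs] := boolP (x \in s); last first.
    by exists 0; split=> // w; rewrite scaler0 hs.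
  have [|h hh] := @injective_extend _ _ _ _ e (dsum_proj J x \o g) hJ.
    move=> w ew; rewrite /= -[dsum_proj _ _ _]/(g _ x) hg ew.
    by rewrite -(linear0 e) -hg linear0.
  exists (h (1 : A)); split=> // w.
  rewrite -linearZ -[g w x]/((dsum_proj J x \o g) w) -hh; congr (h _).
  by rewrite /GRing.scale /= mulr1.
have fm : finite_support m by exists s => x; apply: (hm x).1.
exists (Dsum fm) => _ /he[w <-]; rewrite -hg; apply: dsum_ext => x.
by rewrite (hm x).2 /= addr0.
Qed.

Section Coresolution.
Variables (W : lmodType A) (I : coresolution W).

Definition dsum_coresolution : coresolution (dsum W) :=
  @Coresolution _ _ (fun i => dsum (I i)) (fun i => dsum_map (cores_d I i))
    (dsum_map (cores_aug I)) (dsum_map_inj (@cores_aug_inj _ _ I))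
    (dsum_map_exact (@cores_exact0 _ _ I))
    (fun i => dsum_map_exact (@cores_exact _ _ I i)).
End Coresolution.

Lemma dsum_idim (hA : noetherian A) W n : idim_le n W -> idim_le n (dsum W).
Proof.
case=> I [hI vI]; exists (dsum_coresolution I); split.
  by move=> i; apply: dsum_injective.
by move=> i ni f; apply: dsum_ext => x; apply: vI.
Qed.

Lemma sum_support V (f : S -> V) (s t : seq S) : uniq s -> uniq t ->
  {subset s <= t} -> (forall x, x \notin s -> f x = 0) ->
  \sum_(x <- t) f x = \sum_(x <- s) f x.
Proof.
move=> us ut st h0; rewrite (bigID (mem s)) /= [X in _ + X]big1 ?addr0 => [|x /h0//].
rewrite -big_filter; apply: perm_big; apply: uniq_perm => //.
  exact: filter_uniq.
by move=> x; rewrite mem_filter andb_idr //; apply: st.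
Qed.

Lemma dsum_total V (c : S -> V) :
  exists h : {linear dsum A^o -> V}, forall (f : dsum A^o) (s : seq S),
    uniq s -> (forall x, x \notin s -> f x = 0) ->
    h f = \sum_(x <- s) (f x : A) *: c x.
Proof.
(* Lists covering a support are not unique. [T] demands the same value on all of them, so that two
   elements can be summed over a common list. *)
pose T (f : dsum A^o) y := forall s : seq S,
  uniq s -> (forall x, x \notin s -> f x = 0) -> y = \sum_(x <- s) (f x : A) *: c x.
have supp (f : dsum A^o) : exists2 s, uniq s & forall x, x \notin s -> f x = 0.
  have [s hs] := dsum_finite f; exists (undup s); first exact: undup_uniq.
  by move=> x; rewrite mem_undup; apply: hs.
have TP (f : dsum A^o) s y : uniq s -> (forall x, x \notin s -> f x = 0) ->
    y = \sum_(x <- s) (f x : A) *: c x -> T f y.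
  move=> us hs -> t ut ht.
  have st : {subset s <= undup (s ++ t)} by move=> x xs; rewrite mem_undup mem_cat xs.
  have tt : {subset t <= undup (s ++ t)}.
    by move=> x xs; rewrite mem_undup mem_cat xs orbT.
  rewrite -(sum_support us (undup_uniq _) st) => [|x /hs ->]; last exact: scale0r.
  by rewrite -(sum_support ut (undup_uniq _) tt) => // x /ht ->; apply: scale0r.
have [h hh] : exists h : {linear dsum A^o -> V}, forall f, T f (h f).
  apply: choose_linear => [f|f y y' hy hy'|a f g y z hy hz].
  - have [s us hs] := supp f.
    by exists (\sum_(x <- s) (f x : A) *: c x); apply: TP us hs _.
  - by have [s us hs] := supp f; rewrite (hy s us hs) (hy' s us hs).
  have [s us hs] := supp f; have [t ut ht] := supp g.
  have uu := undup_uniq (s ++ t).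
  have hf x : x \notin undup (s ++ t) -> f x = 0.
    by rewrite mem_undup mem_cat negb_or => /andP[/hs].
  have hg x : x \notin undup (s ++ t) -> g x = 0.
    by rewrite mem_undup mem_cat negb_or => /andP[_ /ht].
  apply: (TP _ _ _ uu) => [x xn|]; first by rewrite dsumE hf // hg // scaler0 addr0.
  rewrite (hy _ uu hf) (hz _ uu hg) scaler_sumr -big_split.
  by apply: eq_bigr => x _; rewrite dsumE scalerDl scalerA.
by exists h => f s; apply: hh.
Qed.

End DirectSum.

(** * Projective modules as retracts of free modules *)

Section ProjectiveRetract.
Variable A : pzRingType.
Implicit Types V P : lmodType A.

Lemma projective_retract_dsum P : projective P ->
  exists (s : {linear P -> dsum P A^o}) (r : {linear dsum P A^o -> P}),
    forall x, r (s x) = x.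
Proof.
move=> hP; have [r hr] := @dsum_total A P P idfun.
have er : epi r.
  move=> y; have fy : finite_support (fun x : P => if x == y then 1 else 0 : A^o).
    by exists [:: y] => x; rewrite inE => /negbTE ->.
  exists (Dsum fy); rewrite (hr _ [:: y]) // => [|x]; last first.
    by rewrite inE /= => /negbTE ->.
  by rewrite big_seq1 /= eqxx scale1r.
have [s hs] := hP _ _ r (idfun : {linear P -> P}) er.
by exists s, r.
Qed.

Lemma idim_ext_zero_projective (hA : noetherian A) k m P
    (X : nat -> lmodType A) (d : forall i, {linear X i.+1 -> X i}) :
  idim_le k (A^o : lmodType A) -> (k <= m)%N -> projective P ->
  (forall i, projective (X i)) -> (forall i, exact_at (d i.+1) (d i)) ->
  ext_zero d m.+1 P.
Proof.
move=> /(@dsum_idim _ P hA)[I [hI vI]] km hP hX hd f fd.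
have [s [r rs]] := projective_retract_dsum hP.
have [||g hg] := @ext_zero_coresolution _ _ d _ I m.+1 hX hd hI _ (s \o f).
- by move=> u _ x; apply: vI.
- by move=> x /=; rewrite fd linear0.
by exists (r \o g) => x /=; rewrite -hg /= rs.
Qed.

End ProjectiveRetract.

(** * Duality and flatness *)

Lemma hom_fun_comb (A : pzRingType) (U V : lmodType A) (f : Defs.hom U V) n
    (c : 'I_n -> A) (x : 'I_n -> U) :
  hom_fun f (\sum_i c i *: x i) = \sum_i c i *: hom_fun f (x i).
Proof.
pose g : {linear U -> V} := f; rewrite -[LHS]/(g _) linear_sum.
by apply: eq_bigr => i _; rewrite linearZ.
Qed.

Lemma linear_comb (A : pzRingType) (U V : lmodType A) (f : {linear U -> V}) n
    (c : 'I_n -> A) (x : 'I_n -> U) :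
  f (\sum_i c i *: x i) = \sum_i c i *: f (x i).
Proof. exact: hom_fun_comb. Qed.

Section Duality.
Variable R : pzRingType.

Section Right.
Implicit Types Y Z : lmodType R^c.

Definition rmap_fun Y Z (f : {linear Y -> Z}) (g : rdual Z) : rdual Y :=
  ((g : {linear Z -> R^c^o}) \o f : {linear Y -> R^c^o}).

Lemma rmap_linear Y Z (f : {linear Y -> Z}) : linear (rmap_fun f).
Proof. by move=> a g h; apply: hom_ext. Qed.

Definition rmap Y Z (f : {linear Y -> Z}) : {linear rdual Z -> rdual Y} :=
  mk_hom (rmap_linear f).

Lemma rmapE Y Z (f : {linear Y -> Z}) g x :
  hom_fun (rmap f g) x = hom_fun g (f x).
Proof. by []. Qed.

Definition reval Y (y : Y) : {linear rdual Y -> R^o} := sigma y.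

Lemma revalE Y (y : Y) f : reval y f = hom_fun f y. Proof. by []. Qed.

Lemma rdual_fg_projective Y : fg_projective Y -> fg_projective (rdual Y).
Proof.
case=> n [x [phi hx]]; exists n, (phi : 'I_n -> rdual Y), (fun i => reval (x i)) => f.
apply: hom_ext => y; rewrite [y in LHS]hx -[RHS]revalE.
by rewrite hom_fun_comb linear_comb.
Qed.

Lemma rdual_projective Y : fg_projective Y -> projective (rdual Y).
Proof. by move=> h; apply/fg_projectiveP/rdual_fg_projective. Qed.

(** By the dual basis f = sum_i f(x_i) phi_i, so [u] is evaluation at sum_i x_i u(phi_i). *)
Lemma rdual_reflexive Y (u : {linear rdual Y -> R^o}) : fg_projective Y ->
  exists y, forall f, u f = hom_fun f y.
Proof.
case=> n [x [phi hx]]; exists (\sum_i (u (phi i) : R^c) *: x i) => f.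
have {1}-> : f = \sum_i (hom_fun f (x i) : R) *: (phi i : rdual Y).
  apply: hom_ext => y; rewrite [y in LHS]hx -[RHS]revalE.
  by rewrite hom_fun_comb linear_comb.
by rewrite hom_fun_comb linear_comb.
Qed.

End Right.

Section Left.
Implicit Types P Q : lmodType R.

Definition lmap P Q (f : {linear P -> Q}) : {linear ldual Q -> ldual P} :=
  mk_hom (dual_map_linear f).

Lemma lmapE P Q (f : {linear P -> Q}) g x :
  hom_fun (lmap f g) x = hom_fun g (f x).
Proof. by []. Qed.

Definition leval_fun P (p : P) (f : ldual P) : R^c^o := hom_fun f p.

Lemma leval_linear P (p : P) : linear (leval_fun p). Proof. by []. Qed.

Definition leval P (p : P) : {linear ldual P -> R^c^o} := mk_hom (leval_linear p).

Lemma levalE P (p : P) f : leval p f = hom_fun f p. Proof. by []. Qed.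

Lemma ldual_fg_projective P : fg_projective P -> fg_projective (ldual P).
Proof.
case=> n [x [phi hx]]; exists n, (phi : 'I_n -> ldual P), (fun i => leval (x i)) => f.
apply: hom_ext => p; rewrite [p in LHS]hx -[RHS]levalE.
by rewrite hom_fun_comb linear_comb.
Qed.

Lemma ldual_reflexive P (u : {linear ldual P -> R^c^o}) : fg_projective P ->
  exists p, forall f, u f = hom_fun f p.
Proof.
case=> n [x [phi hx]]; exists (\sum_i (u (phi i) : R) *: x i) => f.
have {1}-> : f = \sum_i (hom_fun f (x i) : R^c) *: (phi i : ldual P).
  apply: hom_ext => p; rewrite [p in LHS]hx -[RHS]levalE.
  by rewrite hom_fun_comb linear_comb.
by rewrite hom_fun_comb linear_comb.
Qed.

End Left.
End Duality.

(** * Flat dimension and the vanishing of Tor *)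

Section Flatness.
Variable R : pzRingType.

Section FlatExact.
Variables (Q2 Q1 Q0 : lmodType R^c) (d2 : {linear Q2 -> Q1}) (d1 : {linear Q1 -> Q0}).
Variable F : lmodType R.
Hypothesis ex : exact_at d2 d1.

Lemma tens_hom_linear (Q : lmodType R^c) (q : Q) (y : F) :
  linear (fun f : rdual Q => (hom_fun f q : R) *: y).
Proof. by move=> a f g; rewrite -[hom_fun _ _]/(_ + _) scalerDl -scalerA. Qed.

(** The image of q (x) y under the canonical map Q (x) F -> Hom(Q^*, F), an isomorphism for Q
    finitely generated projective. *)
Definition tens_hom (Q : lmodType R^c) (q : Q) (y : F) : Defs.hom (rdual Q) F :=
  mk_hom (tens_hom_linear q y).

Definition hom_im (g : Defs.hom (rdual Q1) F) : Prop :=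
  exists h : {linear rdual Q2 -> F}, forall f, hom_fun g f = h (rmap d2 f).

Lemma hom_im_subgroup : subgroup hom_im.
Proof.
split=> [|g g' [h hh] [h' hh']].
  by exists \0.
by exists (h \- h') => f; rewrite -[RHS]/(h _ - h' _) -hh -hh'.
Qed.

(** Induces a map from (Q1 / ker d1) (x) F back to Hom(Q1^*, F) modulo what comes from Q2; the
    choice of representative is immaterial because ker d1 = im d2. *)
Definition im_tens (b : lquo (ker_submodule d1)) (y : F) : zquo hom_im_subgroup :=
  zpi _ (tens_hom (lquo_repr b) y).

Lemma im_tensE q y :
  im_tens (lquo_pi (ker_submodule d1) q) y = zpi _ (tens_hom q y).
Proof.
apply/zpiP; pose b := lquo_pi (ker_submodule d1) q.
have : lquo_pi (ker_submodule d1) (lquo_repr b - q) = 0.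
  by rewrite linearB; apply/eqP; rewrite subr_eq0; apply/eqP/lquo_reprK.
move=> /lquo_pi0P/ex[z hz].
exists (tens_hom z y : {linear _ -> _}) => f.
rewrite hom_funD -[hom_fun (- _) _]/(- _) /= -/b.
rewrite -[RHS]/((hom_fun (rmap d2 f) z : R) *: y) rmapE hz.
pose f' : {linear Q1 -> R^c^o} := f.
rewrite -[hom_fun f (lquo_repr b - q)]/(f' _) linearB.
exact: esym (scalerBl _ _ _).
Qed.

Lemma im_tens_balanced : balanced im_tens.
Proof.
have piE := lquo_pi_epi (ker_submodule d1).
split=> [b b' y|b y y'|r b y].
- have [q <-] := piE b; have [q' <-] := piE b'.
  rewrite -linearD !im_tensE -zpiD; congr (zpi _ _); apply: hom_ext => f.
  pose f' : {linear Q1 -> R^c^o} := f.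
  rewrite hom_funD -[LHS]/((f' (q + q') : R) *: y) linearD.
  exact: scalerDl.
- have [q <-] := piE b.
  rewrite !im_tensE -zpiD; congr (zpi _ _); apply: hom_ext => f.
  exact: scalerDr.
- have [q <-] := piE b.
  rewrite -linearZ !im_tensE; congr (zpi _ _); apply: hom_ext => f.
  pose f' : {linear Q1 -> R^c^o} := f.
  rewrite -[LHS]/((f' ((r : R^c) *: q) : R) *: y) linearZ.
  exact: esym (scalerA _ _ _).
Qed.

Lemma tensor_lift_sum (X : lmodType R^c) (G : zmodType) (b : X -> F -> G) n
    (x : 'I_n -> X) (y : 'I_n -> F) : balanced b ->
  tensor_lift b (\sum_i tens (x i) (y i)) = \sum_i b (x i) (y i).
Proof.
move=> hb; rewrite (big_morph _ (fun u v => tensor_liftD u v hb) (tensor_lift0 hb)).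
by apply: eq_bigr => i _; rewrite tensor_lift_tens.
Qed.

Lemma tens_suml (X : lmodType R^c) n (x : 'I_n -> X) (y : F) :
  tens (\sum_i x i) y = \sum_i tens (x i) y.
Proof.
have [bD _ _] := balanced_tens X F.
apply: (big_morph (fun x => tens x y)) => [u v|]; first exact: bD.
by apply: (addrI (tens 0 y)); rewrite -bD !addr0.
Qed.

Lemma tens_sumr (X : lmodType R^c) n (x : X) (y : 'I_n -> F) :
  tens x (\sum_i y i) = \sum_i tens x (y i).
Proof.
have [_ bD _] := balanced_tens X F.
apply: (big_morph (fun y => tens x y)) => [u v|]; first exact: bD.
by apply: (addrI (tens x 0)); rewrite -bD !addr0.
Qed.

(* With dual bases (x_a, phi_a) of Q1 and (z_c, chi_c) of Q0, the map g
   corresponds to the tensor sum_a x_a (x) g(phi_a); the hypothesis says that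
   it dies in Q0 (x) F, hence, F being flat, already in im d1 (x) F. *)
Lemma flat_exact (g : {linear rdual Q1 -> F}) :
  flat F -> fg_projective Q1 -> fg_projective Q0 ->
  (forall f, g (rmap d1 f) = 0) ->
  exists h : {linear rdual Q2 -> F}, forall f, g f = h (rmap d2 f).
Proof.
move=> fF [n [x [phi hx]]] [m [z [chi hz]]] g0.
have [i hi] : exists i : {linear lquo (ker_submodule d1) -> Q0},
    forall q, i (lquo_pi _ q) = d1 q.
  by apply: coimage_lift; [exact: lquo_pi_epi | move=> q /lquo_pi0P].
have ii : injective i.
  apply: linear_ker_inj => u; have [q <-] := lquo_pi_epi _ u.
  by rewrite hi => h; apply/lquo_pi0P.
pose px a := lquo_pi (ker_submodule d1) (x a).
pose u : tensor _ F := \sum_a tens (px a) (g (phi a)).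
have bi : balanced (fun b y => tens (i b) y : tensor Q0 F).
  have [b1 b2 b3] := balanced_tens Q0 F.
  split=> [b b' y|b y y'|r b y].
  - by rewrite linearD; apply: b1.
  - exact: b2.
  - by rewrite linearZ; apply: b3.
have [_ _ bZ] := balanced_tens Q0 F.
have iu0 : tensor_map (F := F) i u = 0.
  rewrite /tensor_map tensor_lift_sum //.
  transitivity (\sum_c \sum_a tens (z c) ((chi c (d1 (x a)) : R) *: g (phi a))).
    rewrite exchange_big; apply: eq_bigr => a _.
    rewrite hi {1}(hz (d1 (x a))) tens_suml.
    by apply: eq_bigr => c _; apply: bZ.
  apply: big1 => c _; rewrite -tens_sumr.
  have -> : \sum_a (chi c (d1 (x a)) : R) *: g (phi a) = g (rmap d1 (chi c)).
    rewrite -linear_comb; congr (g _); apply: hom_ext => q.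
    rewrite rmapE -revalE linear_comb.
    pose f : {linear Q1 -> R^c^o} := chi c \o d1.
    rewrite -[RHS]/(f q) [in RHS](hx q) linear_comb.
    exact: eq_bigr.
  rewrite g0; have [_ bD _] := balanced_tens Q0 F.
  by apply: (addrI (tens (z c) 0)); rewrite -bD !addr0.
have u0 : u = 0.
  apply: (fF _ _ _ ii); rewrite iu0; symmetry.
  exact: (tensor_lift0 bi).
have : tensor_lift im_tens u = 0.
  by rewrite u0; apply: (tensor_lift0 im_tens_balanced).
rewrite /u tensor_lift_sum; last exact: im_tens_balanced.
under eq_bigr => a _ do rewrite im_tensE.
rewrite -(big_morph _ (zpiD hom_im_subgroup) (erefl (zpi hom_im_subgroup 0))).
move=> /zpi0P[h hh]; exists h => f; rewrite -hh.
have homs k (t : 'I_k -> Defs.hom (rdual Q1) F) :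
    hom_fun (\sum_a t a) f = \sum_a hom_fun (t a) f.
  by apply: (big_morph (fun v : Defs.hom (rdual Q1) F => hom_fun v f)).
rewrite homs; have {1}-> : f = \sum_a (hom_fun f (x a) : R) *: (phi a : rdual Q1).
  apply: hom_ext => q; rewrite [q in LHS]hx -[RHS]revalE.
  by rewrite hom_fun_comb linear_comb.
by rewrite linear_comb.
Qed.
End FlatExact.

Lemma fdim_shift n (M : lmodType R) : fdim_le n.+1 M ->
  exists (F K : lmodType R) (i : {linear K -> F}) (p : {linear F -> M}),
    [/\ short_exact i p, flat F & fdim_le n K].
Proof.
case=> P [hP vP]; have [i hi] := res_short_exact P.
exists (P 0), _, i, (res_aug P); split=> //.
by exists (res_shift P); split=> [j|j nj]; [apply: hP|apply: vP].
Qed.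

(** With Hom(Q_i^*, M) in place of Q_i (x) M this is Tor_(j+1)(coker (d 0), M) = 0. The induction
    replaces M by the kernel of a map from a flat module onto M and lowers j. *)
Lemma fdim_exact (Q : nat -> lmodType R^c) (d : forall i, {linear Q i.+1 -> Q i})
    n (M : lmodType R) j (g : {linear rdual (Q j.+1) -> M}) :
  (forall i, fg_projective (Q i)) -> (forall i, exact_at (d i.+1) (d i)) ->
  fdim_le n M -> (n <= j)%N -> (forall f, g (rmap (d j) f) = 0) ->
  exists h : {linear rdual (Q j.+2) -> M}, forall f, g f = h (rmap (d j.+1) f).
Proof.
move=> hQ hd; elim: n M j g => [|n IHn] M j g.
  case=> P [hP vP] _ g0.
  have augi : forall x, res_aug P x = 0 -> x = 0.
    by move=> x /res_exact0[y <-]; rewrite (vP 1 isT y) linear0.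
  have [g' hg'] := rdual_projective (hQ j.+1) g (@res_aug_epi _ _ P).
  have [|h hh] := flat_exact (hd j) (hP 0) (hQ _) (hQ _) (g := g').
    by move=> f; apply: augi; rewrite hg'.
  by exists (res_aug P \o h) => f; rewrite /= -hh hg'.
move=> /fdim_shift[F [K [i [p [[ii ex ep] hF hK]]]]].
case: j g => [//|j] g nj g0.
have [g' hg'] := rdual_projective (hQ j.+2) g ep.
have [|g1 hg1] := @inj_lift _ _ _ _ i (g' \o rmap (d j.+1)) ii.
  by move=> f; apply/ex; rewrite -(g0 f) -hg'.
have [|w hw] := IHn _ j g1 hK nj.
  move=> f; apply: ii; rewrite hg1 linear0 /=.
  suff -> : rmap (d j.+1) (rmap (d j) f) = 0 by rewrite linear0.
  apply: hom_ext => x; rewrite !rmapE (exact_comp0 (hd _)).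
  exact: (linear0 (f : {linear _ -> R^c^o})).
(* The lift [g'] fails to be a cocycle by a map into K; the induction hypothesis supplies [w] to
   correct it. *)
have [h hh] : exists h : {linear rdual (Q j.+3) -> F},
    forall f, g' f - i (w f) = h (rmap (d j.+2) f).
  apply: (flat_exact (hd _) (g := g' \- (i \o w)) hF (hQ _) (hQ _)) => f /=.
  by rewrite -hw hg1 /= subrr.
exists (p \o h) => f; rewrite /= -hh linearB hg' (exact_comp0 ex).
by rewrite subr0.
Qed.
End Flatness.

(** * Grades of torsion submodules *)

Section Cones.
Variable A : pzRingType.
Implicit Types U V W M N : lmodType A.

Lemma ext_zero_fg_projective (X : nat -> lmodType A)
    (d : forall i, {linear X i.+1 -> X i}) m W :
  fg_projective W -> ext_zero d m (A^o : lmodType A) -> ext_zero d m W.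
Proof.
move=> [n [x [phi hx]]]; case: m => [|m] hE f fd.
  move=> t; rewrite (hx (f t)); apply: big1 => i _.
  rewrite -[phi i _]/((phi i \o f) t) (hE (phi i \o f)) ?scale0r // => y.
  by rewrite /= fd linear0.
have /choice[h hh] i : exists h : {linear X m -> A^o},
    forall t, phi i (f t) = h (d m t).
  by apply: (hE (phi i \o f)) => y; rewrite /= fd linear0.
have [g hg] : exists g : {linear X m -> W},
    forall t, g t = \sum_i (h i t : A) *: x i.
  apply: mk_linear => a p q; rewrite scaler_sumr -big_split.
  by apply: eq_bigr => i _; rewrite linearP scalerDl scalerA.
by exists g => t; rewrite hg [LHS]hx; apply: eq_bigr => i _; rewrite hh.
Qed.

(* [L_0 = 0 -> L_1 -> ... -> L_(i+1)] resolves coker (delta i), so a map from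
   coker (d 0) to it vanishes when all the Ext^m(coker (d 0), L_p) do. *)
Lemma cochain_chase (L : nat -> lmodType A) (delta : forall p, {linear L p -> L p.+1})
    (X : nat -> lmodType A) (d : forall i, {linear X i.+1 -> X i}) i
    (z : {linear X 0 -> L i.+1}) :
  (forall x : L 0, x = 0) -> (forall p x, delta p.+1 (delta p x) = 0) ->
  (forall p, (p < i)%N -> exact_at (delta p) (delta p.+1)) ->
  (forall j, projective (X j)) -> (forall j, exact_at (d j.+1) (d j)) ->
  (forall m p, (m <= i)%N -> ext_zero d m (L p)) ->
  (forall x, exists y, delta i y = z (d 0 x)) ->
  forall t, exists y, delta i y = z t.
Proof.
move=> L0 dd hL hX hd hE hz.
have claim p m : (p + m.+1)%N = i.+1 -> forall f : {linear X m.+1 -> L p},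
    (forall x, delta p (f (d m.+1 x)) = 0) ->
    exists h : {linear X m -> L p}, forall x, delta p (f x) = delta p (h (d m x)).
  elim: p m => [|p IHp] m pm f fd.
    by exists \0 => x; rewrite [f x]L0.
  have [pi mi] : (p < i)%N /\ (m < i)%N.
    by move: pm; rewrite !addnS addSn => -[<-]; rewrite !ltnS leq_addr leq_addl.
  have [|f' hf'] := @projective_lift _ _ _ _ (delta p) (f \o d m.+1) (hX _).
    by move=> x; apply/(hL _ pi)/fd.
  have [||h' hh'] := IHp m.+1 _ f'; first by rewrite addnS -addSn.
    by move=> x; rewrite hf' /= (exact_comp0 (hd _)) linear0.
  have [h hh] : exists h : {linear X m -> L p.+1},
      forall x, f x - delta p (h' x) = h (d m x).
    apply: (hE m.+1 p.+1 mi (f \- (delta p \o h'))) => x.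
    by rewrite /= -hh' hf' subrr.
  exists h => x; rewrite -hh linearB (dd p).
  by rewrite subr0.
have [f hf] := @projective_lift _ _ _ _ (delta i) (z \o d 0) (hX 1) hz.
have [|h hh] := claim i 0 (addn1 _) f.
  by move=> x; rewrite hf /= (exact_comp0 (hd 0)) linear0.
have z0 : forall x, z x - delta i (h x) = 0.
  apply: (hE 0 i.+1 (leq0n _) (z \- (delta i \o h))) => x.
  by rewrite /= -hh hf subrr.
by move=> t; exists (h t); apply/eqP; rewrite eq_sym -subr_eq0 z0.
Qed.

Lemma chain_lift N (Q : resolution N) (S : nat -> lmodType A)
    (dS : forall i, {linear S i.+1 -> S i}) (e : {linear S 0 -> N}) :
  (forall i, projective (S i)) -> (forall x, e (dS 0 x) = 0) ->
  (forall i x, dS i (dS i.+1 x) = 0) ->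
  exists a : forall i, {linear S i -> Q i},
    (forall s, res_aug Q (a 0 s) = e s) /\
    forall i s, res_d Q i (a i.+1 s) = a i (dS i s).
Proof.
move=> hS ed dd.
(* The existence of the next lift is carried along with each map, so that the recursion can choose
   it. *)
pose cyc i (a : {linear S i -> Q i}) :=
  forall s, exists y, res_d Q i y = a (dS i s).
have nxt i (a : {linear S i -> Q i}) : cyc i a ->
    exists a' : {linear S i.+1 -> Q i.+1},
      (forall s, res_d Q i (a' s) = a (dS i s)) /\ cyc i.+1 a'.
  move=> ca; have [a' ha'] := @projective_lift _ _ _ _ (res_d Q i) (a \o dS i) (hS _) ca.
  exists a'; split=> // s; apply/res_exact.
  by rewrite ha' /= dd linear0.
have [a0 ha0] := hS 0 _ _ (res_aug Q) e (@res_aug_epi _ _ Q).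
have ca0 : cyc 0 a0 by move=> s; apply/res_exact0; rewrite ha0 ed.
pose step i (a : {a : {linear S i -> Q i} | cyc i a}) :
    {a : {linear S i.+1 -> Q i.+1} | cyc i.+1 a} :=
  let w := cid (nxt i (sval a) (svalP a)) in exist _ (sval w) (svalP w).2.
pose fix al i : {a : {linear S i -> Q i} | cyc i a} :=
  if i is i'.+1 then step i' (al i') else exist _ a0 ca0.
exists (fun i => sval (al i)); split=> // i s /=.
exact: (svalP (cid (nxt i (sval (al i)) (svalP (al i))))).1.
Qed.

(** * Mapping cones *)

Section Cone.
Variables (N : lmodType A) (Q : resolution N) (S : nat -> lmodType A)
  (dS : forall i, {linear S i.+1 -> S i}) (e : {linear S 0 -> N})
  (a : forall i, {linear S i -> Q i}).

(** [S] moved up by one degree, with 0 in degree 0: index i.+1 of the tail always means S_i. *)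
Definition cone_tail : nat -> lmodType A := ccons (zero_mod A) S.
Definition cone_tail_d : forall i, {linear cone_tail i.+1 -> cone_tail i} :=
  ccons_d (\0 : {linear S 0 -> zero_mod A}) dS.

Lemma cone_tail_dd : (forall i, exact_at (dS i.+1) (dS i)) ->
  forall i x, cone_tail_d i (cone_tail_d i.+1 x) = 0.
Proof. by move=> hd [|i] x //=; apply: exact_comp0 (hd i) _. Qed.

Definition cone (i : nat) : lmodType A := (Q i * cone_tail i)%type.

Definition cone_d_fun i (x : cone i.+1) : cone i :=
  (res_d Q i x.1 + a i x.2, - cone_tail_d i x.2).

Lemma cone_d_linear i : linear (@cone_d_fun i).
Proof.
move=> r x y; congr (_, _); rewrite /= !linearP // scalerDr.
by rewrite addrACA.
Qed.

Definition cone_d i : {linear cone i.+1 -> cone i} := mk_hom (@cone_d_linear i).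

Lemma cone_dE i x :
  cone_d i x = (res_d Q i x.1 + a i x.2, - cone_tail_d i x.2).
Proof. by []. Qed.

Lemma cone_inl_linear i : linear (fun q : Q i => (q, 0) : cone i).
Proof. by move=> r x y; congr (_, _); rewrite /= scaler0 addr0. Qed.

Lemma cone_inr_linear i : linear (fun s : cone_tail i => (0, s) : cone i).
Proof. by move=> r x y; congr (_, _); rewrite /= scaler0 addr0. Qed.

Definition cone_inl i : {linear Q i -> cone i} := mk_hom (@cone_inl_linear i).
Definition cone_inr i : {linear cone_tail i -> cone i} := mk_hom (@cone_inr_linear i).

Lemma coneE i (x : cone i) : x = cone_inl i x.1 + cone_inr i x.2.
Proof. by case: x => q s; congr (_, _); rewrite /= ?addr0 ?add0r. Qed.

(** The cone resolves N / im e, as [S] resolves im e. In degree 1 a cycle (q, s) has e s = 0, and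
    there exactness of [S] at [e] enters. *)
Lemma cone_exact :
  (forall s, res_aug Q (a 0 s) = e s) ->
  (forall i s, res_d Q i (a i.+1 s) = a i (dS i s)) ->
  exact_at (dS 0) e -> (forall i, exact_at (dS i.+1) (dS i)) ->
  forall i, exact_at (cone_d i.+1) (cone_d i).
Proof.
move=> ha0 ha h0 hd i.
have dd x : cone_tail_d i (cone_tail_d i.+1 x) = 0 by apply: cone_tail_dd.
move=> [q s]; split=> [|[[q' s'] <-]]; last first.
  rewrite !cone_dE /= linearD (exact_comp0 (@res_exact _ _ Q i)) add0r ha.
  by rewrite !linearN /= addrN; congr (_, _); rewrite opprK; apply: dd.
rewrite cone_dE /= => -[h1 /eqP]; rewrite oppr_eq0 => /eqP h2.
have [s' hs'] : exists s', s = - dS i s'.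
  suff [s' hs'] : exists s', dS i s' = s by exists (- s'); rewrite linearN opprK.
  case: i {dd} q s h1 h2 => [|i] q s h1 h2; last exact/hd.
  apply/h0; rewrite -ha0; have := congr1 (res_aug Q) h1.
  by rewrite linearD (exact_comp0 (@res_exact0 _ _ Q)) add0r linear0.
have [q' hq'] : exists q', res_d Q i.+1 q' = q - a i.+1 s'.
  by apply/res_exact; rewrite linearB ha -[RHS]h1 hs' linearN.
exists (q', s'); rewrite cone_dE /= hq' subrK.
by rewrite hs'.
Qed.

Lemma cone_fg_projective : (forall i, fg_projective (Q i)) ->
  (forall i, fg_projective (S i)) -> forall i, fg_projective (cone i).
Proof.
move=> hQ hS i; apply: prod_fg_projective; first exact: hQ.
by case: i => [|i] /=; [apply: zero_mod_fg_projective | apply: hS].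
Qed.

End Cone.
End Cones.

Section Grade.
Variable R : pzRingType.

Lemma rmap_comp0 (X Y Z : lmodType R^c) (f : {linear X -> Y}) (g : {linear Y -> Z}) :
  (forall x, g (f x) = 0) -> forall u, rmap f (rmap g u) = 0.
Proof.
move=> gf u; apply: hom_ext => x; rewrite !rmapE gf.
exact: (linear0 (u : {linear Z -> R^c^o})).
Qed.

Lemma ext_zero_rdual (X : nat -> lmodType R^c) (d : forall i, {linear X i.+1 -> X i}) j :
  ext_zero d j.+1 (R^c^o : lmodType R^c) <->
  forall u, rmap (d j.+1) u = 0 -> exists v, u = rmap (d j) v.
Proof.
split=> h u hu.
  have [|g hg] := h u; last by exists g; apply: hom_ext.
  by move=> x; rewrite -[u _]/(hom_fun (rmap (d j.+1) u) x) hu.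
have [|v hv] := h u; first by apply: hom_ext => x; rewrite rmapE; apply: hu.
by exists v => x; rewrite -[LHS]/(hom_fun u x) hv.
Qed.

Section Kernel.
Variables (k : nat) (I : coresolution (R^o : lmodType R)).
Hypotheses (lnoeth : noetherian R) (hI : forall i, injective_module (I i))
  (fdI : forall i, (i <= k)%N -> fdim_le i (I i)).
Variables (N : lmodType R^c) (Q : resolution N) (S : nat -> lmodType R^c)
  (dS : forall i, {linear S i.+1 -> S i}) (e : {linear S 0 -> N}) (n : nat).
Hypotheses (fQ : forall i, fg_projective (Q i)) (fS : forall i, fg_projective (S i))
  (S0 : exact_at (dS 0) e) (Sd : forall i, exact_at (dS i.+1) (dS i))
  (eker : forall (u : {linear N -> R^c^o}) s, u (e s) = 0)
  (nk : (n <= k)%N)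
  (Qn : forall j, (j < n)%N -> ext_zero (res_d Q) j.+1 (R^c^o : lmodType R^c)).

Local Notation tail := (cone_tail S).
Local Notation td := (cone_tail_d dS).

Lemma tail_fg_projective i : fg_projective (tail i).
Proof. by case: i => [|i] /=; [apply: zero_mod_fg_projective | apply: fS]. Qed.

Lemma tail_dd i x : td i (td i.+1 x) = 0.
Proof. exact: cone_tail_dd. Qed.

(* Tor_i(im e, I_m) vanishes in the degrees m <= i: the mapping cone of a lift
   S -> Q resolves N / im e, where Tor_(i+1) vanishes by flat dimension. *)
Lemma kernel_cocycle0 i m (g : {linear rdual (tail i.+1) -> I m}) :
  (i <= n)%N -> (m <= i)%N -> (forall f, g (rmap (td i) f) = 0) ->
  forall t, rmap (td i.+1) t = 0 -> g t = 0.
Proof.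
move=> ile mi g0 t tc.
have [a [ha0 ha]] : exists a : forall i, {linear S i -> Q i},
    (forall s, res_aug Q (a 0 s) = e s) /\
    forall i s, res_d Q i (a i.+1 s) = a i (dS i s).
  apply: chain_lift; first by move=> j; apply: fg_projectiveP.
    exact: exact_comp0.
  by move=> j; apply: exact_comp0.
(* Cocycles of Q^* in degree i are coboundaries or, for i = 0, functionals on N, which vanish on im
   e. Either way [g] kills their pullbacks along a_i, so that [u] exists and turns [g] into a map on
   the dual of the cone. *)
have [|u hu] := @injective_extend _ _ _ _ (rmap (res_d Q i)) (g \o rmap (a i)) (@hI m).
  move=> f fd /=; move: (a) ha0 ha g g0 f fd.
  case: (i) ile => [|j] jn al al0 alS g1 g10 f fd.
    have [|th hth] := @coimage_lift _ _ _ _ (res_aug Q) f (@res_aug_epi _ _ Q).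
      move=> q /res_exact0[y <-].
      by rewrite -[LHS]/(hom_fun (rmap (res_d Q 0) f) y) fd.
    have -> : rmap (al 0) f = 0; last exact: linear0.
    apply: hom_ext => s; rewrite rmapE -[LHS]/(f (al 0 s)) -hth al0.
    exact: eker.
  have [v fv] := (ext_zero_rdual _ _).1 (Qn jn) f fd.
  have -> : rmap (al j.+1) f = rmap (td j.+1) (rmap (al j) v).
    by rewrite fv; apply: hom_ext => s; rewrite !rmapE alS.
  exact: g10.
have [|h hh] := @fdim_exact _ (cone Q S) (cone_d dS a) m (I m) i
    ((g \o rmap (cone_inr Q S i.+1)) \- (u \o rmap (cone_inl Q S i.+1)))
    (cone_fg_projective fQ fS) (cone_exact ha0 ha S0 Sd)
    (fdI (leq_trans mi (leq_trans ile nk))) mi.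
  move=> psi.
  rewrite -[LHS]/(g (rmap (cone_inr Q S i.+1) (rmap (cone_d dS a i) psi)) -
                  u (rmap (cone_inl Q S i.+1) (rmap (cone_d dS a i) psi))).
  have -> : rmap (cone_inl Q S i.+1) (rmap (cone_d dS a i) psi) =
            rmap (res_d Q i) (rmap (cone_inl Q S i) psi).
    apply: hom_ext => q; rewrite !rmapE cone_dE /=.
    by rewrite !linear0 addr0.
  rewrite hu /=.
  have -> : rmap (cone_inr Q S i.+1) (rmap (cone_d dS a i) psi) =
            rmap (a i) (rmap (cone_inl Q S i) psi) -
            rmap (td i) (rmap (cone_inr Q S i) psi).
    apply: hom_ext => s.
    rewrite -[RHS]/(hom_fun psi (cone_inl Q S i (a i s)) -
                    hom_fun psi (cone_inr Q S i (td i s))).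
    pose psi' : {linear cone Q S i -> R^c^o} := psi.
    rewrite -[RHS]/(psi' _ - psi' _) -linearB rmapE; congr (hom_fun psi _).
    by rewrite cone_dE /= linear0 add0r; congr (_, _); rewrite /= ?subr0 ?sub0r.
  by rewrite linearB g0 subr0 subrr.
pose t' : {linear tail i.+1 -> R^c^o} := t.
(* [t] extended by 0 on Q_(i+1) is a cocycle of the cone, so [h] gets evaluated at 0. *)
pose phi : rdual (cone Q S i.+1) := (t' \o snd : {linear cone Q S i.+1 -> R^c^o}).
have := hh phi.
rewrite -[X in X = _]/(g (rmap (cone_inr Q S i.+1) phi) - u (rmap (cone_inl Q S i.+1) phi)).
have -> : rmap (cone_inr Q S i.+1) phi = t by apply: hom_ext.
have -> : rmap (cone_inl Q S i.+1) phi = 0.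
  by apply: hom_ext => q; rewrite rmapE; apply: (linear0 t').
have -> : rmap (cone_d dS a i.+1) phi = 0.
  apply: hom_ext => q; rewrite rmapE -[LHS]/(t' (- td i.+1 q.2)).
  rewrite linearN -[t' _]/(hom_fun (rmap (td i.+1) t) q.2) tc.
  exact: oppr0.
by rewrite !linear0 addr0.
Qed.

(* H^i(S^* ) sits inside coker (delta_i), which has projective dimension at most i
   when the lower cohomology vanishes; but Hom(H^i(S^* ), I_m) = 0 for m <= i, so
   that Ext^m(H^i(S^* ), R) = 0 for m <= i and H^i(S^* ) = 0. *)
Lemma kernel_grade_tail i : (i <= n)%N ->
  forall t, rmap (td i.+1) t = 0 -> exists s, rmap (td i) s = t.
Proof.
elim/ltn_ind: i => i IHi ile.
have Lex p : (p < i)%N -> exact_at (rmap (td p)) (rmap (td p.+1)).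
  move=> pi t; split=> [|[s <-]]; last by apply: rmap_comp0 => x; apply: tail_dd.
  by apply: IHi => //; apply: leq_trans (ltnW pi) ile.
(* Since [tail i.+1] is S_i, [C] is S_i^* modulo the image of S_(i-1)^* and [X] is the cohomology
   H^i inside it. *)
pose C := coker (rmap (td i)); pose pi := coker_pi (rmap (td i)).
pose X (c : C) := exists t, rmap (td i.+1) t = 0 /\ pi t = c.
have hX : submodule X.
  split; first by exists 0; rewrite !linear0.
  by move=> r _ _ [t [ht <-]] [s [hs <-]]; exists (r *: t + s);
    rewrite !linearP ht hs scaler0 addr0.
have fC : fin_gen C.
  apply: epi_fin_gen (@coker_pi_epi _ _ _ (rmap (td i))) _.
  exact/fg_projective_fin_gen/rdual_fg_projective/tail_fg_projective.
have [T [d [e0 [fT he hT0 hTd]]]] :=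
  free_resolution lnoeth (noetherian_fin_gen lnoeth fC hX).
have pT j : projective (T j) := fg_projectiveP (fT j).
have hE m p : (m <= i)%N -> ext_zero d m (rdual (tail p)).
  move=> mi; apply: ext_zero_fg_projective.
    exact/rdual_fg_projective/tail_fg_projective.
  apply: (ext_zero_coresolution (I := I)) => // f fd x.
  have [|g hg] := @injective_extend _ _ _ _ e0 f (@hI m).
    by move=> y /hT0[w <-].
  have [t [tc tx]] : X (e0 x) by apply/he; exists x.
  rewrite -hg -tx; apply: (@kernel_cocycle0 i m (g \o pi)) tc => // y.
  by rewrite /= (exact_comp0 (@coker_exact _ _ _ (rmap (td i)))) linear0.
have [z hz] := pT 0 _ _ pi e0 (@coker_pi_epi _ _ _ (rmap (td i))).
have e00 x : e0 x = 0.
  rewrite -hz; apply/coker_exact.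
  apply: (@cochain_chase _ (fun p => rdual (tail p)) (fun p => rmap (td p)) T d i z) => //.
  - move=> u; apply: hom_ext => y; rewrite [y]zero_modE.
    exact: (linear0 (u : {linear _ -> R^c^o})).
  - by move=> p; apply: rmap_comp0 => y; apply: tail_dd.
  - by move=> y; apply/coker_exact; rewrite hz (exact_comp0 hT0).
move=> t tc; have [x hx] : exists x, e0 x = pi t by apply/he; exists t.
by apply/coker_exact; rewrite -[LHS]hx e00.
Qed.

Lemma kernel_grade i : (i <= n)%N -> ext_zero dS i (R^c^o : lmodType R^c).
Proof.
move=> ile; have H := kernel_grade_tail ile.
case: i ile H => [|i] ile H; last first.
  by apply/ext_zero_rdual => u hu; have [s hs] := H u hu; exists s.
move=> f fd x; have [|s hs] := H f; first by apply: hom_ext => y; apply: fd.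
by rewrite -[LHS]/(hom_fun f x) -hs rmapE; apply: (linear0 (s : {linear _ -> R^c^o})).
Qed.
End Kernel.
End Grade.

(** * Transposes of syzygies *)

Section Transpose.
Variable R : pzRingType.
Variables (P : nat -> lmodType R) (d : forall i, {linear P i.+1 -> P i}).
Hypotheses (fP : forall i, fg_projective (P i))
  (exP : forall i, exact_at (d i.+1) (d i)).

(* [transpose j] is the cokernel of P_j^* -> P_(j+1)^*, and
   [transpose_map j] the map that P_(j+1)^* -> P_(j+2)^* induces on it; its
   kernel is Ext^(j+1)(coker d_0, R). *)
Definition transpose j : lmodType R^c := coker (lmap (d j)).
Definition transpose_pi j : {linear ldual (P j.+1) -> transpose j} :=
  coker_pi (lmap (d j)).

Lemma lmap_comp0 (U V W : lmodType R) (f : {linear U -> V}) (g : {linear V -> W}) :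
  (forall x, g (f x) = 0) -> forall u, lmap f (lmap g u) = 0.
Proof.
move=> gf u; apply: hom_ext => x; rewrite !lmapE gf.
exact: (linear0 (u : {linear W -> R^o})).
Qed.

Lemma transpose_map_ex j : exists h : {linear transpose j -> ldual (P j.+2)},
  forall f, h (transpose_pi j f) = lmap (d j.+1) f.
Proof.
by apply: coker_lift => f; apply: lmap_comp0 => x; apply: (exact_comp0 (@exP j)).
Qed.

Definition transpose_map j := sval (cid (transpose_map_ex j)).

Lemma transpose_mapE j f : transpose_map j (transpose_pi j f) = lmap (d j.+1) f.
Proof. exact: (svalP (cid (transpose_map_ex j))). Qed.

(** A functional on P_(j+1)^* is evaluation at a point p; killing the image of P_j^* means d p = 0,
    so p comes from P_(j+2). Hence all functionals vanish on the kernel of [transpose_map], as the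
    key fact requires. *)
Lemma transpose_functional j (u : {linear transpose j -> R^c^o}) :
  exists q, forall c, u c = hom_fun (transpose_map j c) q.
Proof.
have [p hp] := ldual_reflexive (u \o transpose_pi j) (fP j.+1).
have /exP[q dq] : d j p = 0.
  apply: (fg_projective_sep (fP j)) => f.
  rewrite -[f (d j p)]/(hom_fun (lmap (d j) f) p) -hp /=.
  by rewrite (exact_comp0 (@coker_exact _ _ _ (lmap (d j)))) linear0.
exists q => c; have [f <-] := @coker_pi_epi _ _ _ (lmap (d j)) c.
by rewrite transpose_mapE lmapE dq -hp.
Qed.

Section Gorenstein.
Variables (k : nat) (I : coresolution (R^o : lmodType R)).
Hypotheses (lnoeth : noetherian R) (rnoeth : noetherian R^c)
  (hI : forall i, injective_module (I i))
  (fdI : forall i, (i <= k)%N -> fdim_le i (I i)).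

Section Step.
Variables (j : nat) (Q : resolution (transpose j)) (S : nat -> lmodType R^c)
  (dS : forall i, {linear S i.+1 -> S i}) (e : {linear S 0 -> transpose j})
  (a : forall i, {linear S i -> Q i}).
Hypotheses (he : forall c, transpose_map j c = 0 <-> exists s, e s = c)
  (ha0 : forall s, res_aug Q (a 0 s) = e s)
  (ha : forall i s, res_d Q i (a i.+1 s) = a i (dS i s))
  (S0 : exact_at (dS 0) e) (Sd : forall i, exact_at (dS i.+1) (dS i)).

Definition transpose_step_map : {linear cone Q S 0 -> ldual (P j.+2)} :=
  transpose_map j \o res_aug Q \o fst.

Lemma transpose_step_exact0 :
  exact_at transpose_step_map (transpose_pi j.+1).
Proof.
move=> y; split=> [/coker_exact[f <-]|[x <-]].
  have [q hq] := res_aug_epi Q (transpose_pi j f).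
  by exists (q, 0); rewrite /= hq transpose_mapE.
have [f hf] := @coker_pi_epi _ _ _ (lmap (d j)) (res_aug Q x.1).
apply/coker_exact; exists f.
by rewrite /= -hf transpose_mapE.
Qed.

Lemma transpose_step_exact1 :
  exact_at (cone_d dS a 0) transpose_step_map.
Proof.
move=> [q s]; split=> [|[[q' s'] <-]]; last first.
  rewrite cone_dE /= linearD (exact_comp0 (@res_exact0 _ _ Q)) add0r ha0.
  by apply/he; exists s'.
move=> /he[s0 hs0].
have [q' hq'] : exists q', res_d Q 0 q' = q - a 0 s0.
  by apply/res_exact0; rewrite linearB ha0 hs0 subrr.
exists (q', s0); rewrite cone_dE /= hq' subrK.
by congr (_, _); rewrite [RHS]zero_modE [LHS]zero_modE.
Qed.

(** The kernel of P_(j+2)^* -> [transpose j.+1] is [transpose j] modulo E, with E the kernel of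
    [transpose_map j]; the cone resolves this quotient. *)
Definition transpose_step : resolution (transpose j.+1) :=
  @Resolution _ _ (ccons (ldual (P j.+2)) (cone Q S))
    (ccons_d transpose_step_map (cone_d dS a)) (transpose_pi j.+1)
    (@coker_pi_epi _ _ _ _) transpose_step_exact0
    (ccons_exact transpose_step_exact1 (cone_exact ha0 ha S0 Sd)).

(** A functional on [transpose j] modulo E is evaluation at a point of P_(j+2), hence extends to
    P_(j+2)^*. *)
Lemma transpose_step_ext1 : ext_zero (res_d transpose_step) 1 (R^c^o : lmodType R^c).
Proof.
move=> f fd.
pose f' : {linear cone Q S 0 -> R^c^o} := f.
have f'd x : f' (cone_d dS a 0 x) = 0 by apply: fd.
have [|u hu] := @coimage_lift _ _ _ _ (res_aug Q) (f' \o cone_inl Q S 0)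
    (@res_aug_epi _ _ Q).
  move=> q /res_exact0[y <-]; rewrite -[RHS](f'd (y, 0)) cone_dE /= linear0 addr0.
  by congr (f' (_, _)); rewrite !linear0.
have [q hq] := transpose_functional u.
exists (leval q) => x; rewrite -[LHS]/(f' x) [x in LHS](coneE x) linearD.
have -> : f' (cone_inr Q S 0 x.2) = 0.
  by rewrite [x.2]zero_modE !linear0.
by rewrite addr0 -[LHS]hu hq.
Qed.

(** Shifted by one, this is Ext^(i+1) of [transpose j] modulo E, which lies between Ext^i(E) and
    Ext^(i+1)(transpose j). The hypotheses give the components [g2] and [g1] of a primitive on the
    cone. *)
Lemma transpose_step_ext i :
  ext_zero (res_d Q) i.+1 (R^c^o : lmodType R^c) ->
  (forall t, rmap (cone_tail_d dS i.+1) t = 0 ->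
     exists s, rmap (cone_tail_d dS i) s = t) ->
  ext_zero (res_d transpose_step) i.+2 (R^c^o : lmodType R^c).
Proof.
move=> hQ hS f fd.
pose f' : {linear cone Q S i.+1 -> R^c^o} := f.
have f'd x : f' (cone_d dS a i.+1 x) = 0 by apply: fd.
have [|g1 hg1] := hQ (f' \o cone_inl Q S i.+1).
  move=> q; rewrite -[RHS](f'd (q, 0)) cone_dE /= linear0 addr0.
  by congr (f' (_, _)); rewrite !linear0.
have [g2 hg2] : exists g2 : {linear cone_tail S i -> R^c^o}, forall s,
    g1 (a i s) - f' (cone_inr Q S i.+1 s) = g2 (cone_tail_d dS i s).
  pose h : rdual (cone_tail S i.+1) :=
    (g1 \o a i) \- (f' \o cone_inr Q S i.+1) : {linear cone_tail S i.+1 -> R^c^o}.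
  have [|g2 hg2] := hS h.
    apply: hom_ext => s; rewrite rmapE.
    rewrite -[LHS]/(g1 (a i (dS i s)) - f' (cone_inr Q S i.+1 (dS i s))).
    rewrite -ha -hg1 -[_ - _]/(f' _ - f' _) -linearB -[RHS](f'd (0, s)) cone_dE.
    by congr (f' _); rewrite linear0 add0r; congr (_, _); rewrite /= ?subr0 ?sub0r.
  by exists g2 => s; rewrite -[RHS]/(hom_fun (rmap (cone_tail_d dS i) g2) s) hg2.
have [g hg] : exists g : {linear cone Q S i -> R^c^o},
    forall x, g x = g1 x.1 + (g2 : {linear cone_tail S i -> R^c^o}) x.2.
  by apply: mk_linear => r x y; rewrite !linearP scalerDr addrACA.
exists g => x; rewrite -[LHS]/(f' x) -[RHS]/(g (cone_d dS a i x)) hg cone_dE /=.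
have {}hg1 q : f' (cone_inl Q S i.+1 q) = g1 (res_d Q i q) by apply: hg1.
rewrite [x in LHS](coneE x) linearD hg1 [in RHS]linearD linearN -hg2 opprB.
by rewrite -addrA [g1 (a i _) + _]addrC subrK.
Qed.
End Step.

Lemma transpose_resolution j : (j <= k)%N ->
  exists Q : resolution (transpose j), (forall i, fg_projective (Q i)) /\
    forall i, (i < j)%N -> ext_zero (res_d Q) i.+1 (R^c^o : lmodType R^c).
Proof.
elim: j => [|j IHj] jk.
  have [|Q hQ] := @noetherian_resolution _ rnoeth (transpose 0); last by exists Q.
  apply: epi_fin_gen (@coker_pi_epi _ _ _ (lmap (d 0))) _.
  exact/fg_projective_fin_gen/ldual_fg_projective.
have [Q [fQ hQ]] := IHj (ltnW jk).
have fT : fin_gen (transpose j).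
  apply: epi_fin_gen (@coker_pi_epi _ _ _ (lmap (d j))) _.
  exact/fg_projective_fin_gen/ldual_fg_projective.
have [S [dS [e [fS he S0 Sd]]]] := free_resolution rnoeth
  (noetherian_fin_gen rnoeth fT (ker_submodule (transpose_map j))).
have [a [ha0 ha]] : exists a : forall i, {linear S i -> Q i},
    (forall s, res_aug Q (a 0 s) = e s) /\
    forall i s, res_d Q i (a i.+1 s) = a i (dS i s).
  apply: chain_lift; first by move=> i; apply: fg_projectiveP.
    exact: exact_comp0.
  by move=> i; apply: exact_comp0.
exists (transpose_step he ha0 ha S0 Sd); split.
  apply: ccons_all; first exact: ldual_fg_projective.
  exact: cone_fg_projective.
case=> [|i] ij; first exact: transpose_step_ext1.
apply: transpose_step_ext; first exact: hQ.
apply: (kernel_grade_tail lnoeth hI fdI fQ fS S0 Sd _ (ltnW jk) hQ (ltnW ij)).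
move=> u s; have [q hq] := transpose_functional u; rewrite hq.
by have -> : transpose_map j (e s) = 0 by apply/he; exists s.
Qed.

End Gorenstein.
End Transpose.

Section SelfInjectiveDimension.
Variable R : pzRingType.

(** [P] is [L] read backwards, with L_0 in degree k + 1. Ext^(k+1) is tested on the identity of L_0,
    and a primitive of it retracts [delta 0]. *)
Lemma cochain_pdim (L : nat -> lmodType R) (delta : forall p, {linear L p -> L p.+1}) k :
  (forall p, projective (L p)) -> injective (delta 0) ->
  (forall p, (p < k)%N -> exact_at (delta p) (delta p.+1)) ->
  exists P : resolution (coker (delta k)),
    [/\ forall i, projective (P i), vanish_above k.+1 P &
        (forall W, ext_zero (res_d P) k.+1 W) ->
        exists g : {linear L 1 -> L 0}, forall x, g (delta 0 x) = x].
Proof.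
move=> hL di; elim: k => [|k IHk] hex.
  have ip : short_exact (delta 0) (coker_pi (delta 0)).
    by split=> //; [apply: coker_exact | apply: coker_pi_epi].
  pose T := res_cons (zero_short_exact (L 0)) (zero_resolution R).
  exists (res_cons ip T); split.
  - by case=> [|[|i]] //=; apply: zero_mod_projective.
  - by case=> [|[|i]] //= _ x; apply: zero_modE.
  move=> /(_ (L 0) (idfun : {linear L 0 -> L 0}))[x|g hg]; first by apply: linear0.
  by exists g => x; apply: esym (hg x).
have [P [hP vP sP]] := IHk (fun p pk => hex p (ltnW pk)).
have [i ip _] := coker_short_exact (hex k (ltnSn k)).
exists (res_cons ip P); split=> //; first by case=> [|j] /=.
by case=> [|j] //= hj; apply: vP.
Qed.

Section Dual.
Variables (P : nat -> lmodType R) (d : forall i, {linear P i.+1 -> P i}).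
Hypotheses (fP : forall i, fg_projective (P i))
  (exP : forall i, exact_at (d i.+1) (d i)).

Lemma transpose_map_ext k :
  (forall c, transpose_map exP k c = 0 -> c = 0) ->
  ext_zero d k.+1 (R^o : lmodType R).
Proof.
move=> inj f fd; have [|g hg] := (@coker_exact _ _ _ (lmap (d k)) (f : ldual _)).1.
  apply: inj; rewrite transpose_mapE.
  by apply: hom_ext => x; rewrite lmapE; apply: fd.
by exists g => x; rewrite -[LHS]/(hom_fun (f : ldual _) x) -hg.
Qed.

Lemma torsionless_transpose_ext k :
  torsionless (transpose d k) -> ext_zero d k.+1 (R^o : lmodType R).
Proof.
move=> tl; apply: transpose_map_ext => c hc; apply: tl; apply: hom_ext => u.
pose u' : {linear transpose d k -> R^c^o} := u.
have [q hq] := transpose_functional fP exP u'.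
rewrite -[LHS]/(u' c) -[RHS]/(u' 0) linear0 hq hc; exact: (erefl (0 : R)).
Qed.

Section Gorenstein.
Variables (k : nat) (I : coresolution (R^o : lmodType R)).
Hypotheses (lnoeth : noetherian R) (rnoeth : noetherian R^c)
  (hI : forall i, injective_module (I i))
  (fdI : forall i, (i <= k)%N -> fdim_le i (I i)).

Lemma transpose_fin_gen : fin_gen (transpose d k).
Proof.
apply: epi_fin_gen (@coker_pi_epi _ _ _ (lmap (d k))) _.
exact/fg_projective_fin_gen/ldual_fg_projective.
Qed.

Lemma transpose_reduced_grade : reduced_grade_ge k.+1 (transpose d k).
Proof.
have [Q [fQ hQ]] := transpose_resolution fP exP lnoeth rnoeth hI fdI (leqnn k).
case=> [|j] // /andP[_ jk] X hX.
apply: (@ext_zero_resolution _ _ Q X) hX _; last exact: hQ.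
by move=> i; apply: fg_projectiveP.
Qed.

Lemma findim_ext : findim_le R k -> ext_zero d k.+1 (R^o : lmodType R).
Proof.
move=> fk; apply: transpose_map_ext => c hc.
have [Q [fQ hQ]] := transpose_resolution fP exP lnoeth rnoeth hI fdI (leqnn k).
have [S [dS [e [fS he S0 Sd]]]] := free_resolution rnoeth
  (noetherian_fin_gen rnoeth transpose_fin_gen (ker_submodule (transpose_map exP k))).
have hS i : (i <= k)%N -> ext_zero dS i (R^c^o : lmodType R^c).
  apply: (kernel_grade lnoeth hI fdI fQ fS S0 Sd _ (leqnn k) hQ).
  move=> u s; have [q hq] := transpose_functional fP exP u; rewrite hq.
  by have -> : transpose_map exP k (e s) = 0 by apply/he; exists s.
have [||| X [hX vX sX]] := @cochain_pdim (fun i => rdual (S i)) (fun i => rmap (dS i)) k.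
- by move=> p; apply: rdual_projective.
- apply: linear_ker_inj => f hf; apply: hom_ext => s.
  apply: (hS 0 (leq0n k) f) => x.
  by rewrite -[LHS]/(hom_fun (rmap (dS 0) f) x) hf.
- move=> p pk u; split=> [|[v <-]].
    by move=> /((ext_zero_rdual _ _).1 (hS p.+1 pk))[v ->]; exists v.
  by apply: rmap_comp0 => x; apply: exact_comp0 (Sd p) x.
have fM : fin_gen (coker (rmap (dS k))).
  apply: epi_fin_gen (@coker_pi_epi _ _ _ (rmap (dS k))) _.
  exact/fg_projective_fin_gen/rdual_fg_projective.
have pM : pdim_le k (coker (rmap (dS k))).
  by apply: fk fM _; exists k.+1, X.
(* Lowering the projective dimension from k + 1 to k splits S_0^* -> S_1^*. *)
have [|g hg] := sX; first by move=> W; apply: pdim_ext_zero.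
have [s es] := (he c).1 hc.
(* Dualized back, the splitting makes [dS 0] onto: evaluation at [s] extends through [g] to S_1^*,
   where it is evaluation at some [t]. *)
have [t ht] := rdual_reflexive (reval s \o g) (fS 1).
have ts : dS 0 t = s.
  apply/eqP; rewrite -subr_eq0; apply/eqP/(fg_projective_sep (fS 0)) => f.
  rewrite linearB -[f (dS 0 t)]/(hom_fun (rmap (dS 0) f) t) -ht /=.
  by rewrite hg; apply: subrr.
by rewrite -es -ts (exact_comp0 S0).
Qed.
End Gorenstein.
End Dual.
End SelfInjectiveDimension.

(** * D-chains and finite projective dimension *)

Section FiniteProjectiveDimension.
Variable R : pzRingType.

Lemma projective_descent (X : nat -> lmodType R)
    (d : forall i, {linear X i.+1 -> X i}) k n :
  (forall m, (k <= m)%N -> projective (coker (d m.+1)) -> projective (coker (d m))) ->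
  projective (coker (d (n + k)%N)) -> projective (coker (d k)).
Proof.
move=> H; elim: n => [//|n IHn] h; apply: IHn.
by apply: H => //; apply: leq_addl.
Qed.

(** For m >= k, Ext^(m+1)(M, -) vanishes on projectives, so once the (m+1)-st syzygy is projective
    the m-th is too. Starting at n + k avoids comparing n with k. *)
Lemma idim_Findim k : noetherian R -> idim_le k (R^o : lmodType R) -> Findim_le R k.
Proof.
move=> hR hk M [n hM]; have [P [hP _]] := hM.
apply: (coker_pdim (P := P)) => //; apply: (@projective_descent _ _ k n).
  move=> m km hm; apply: ext_zero_coker (hP m) _; first exact: res_exact.
  by apply: (idim_ext_zero_projective hR hk km hm) => // i; apply: res_exact.
by apply: pdim_coker => //; apply: pdim_le_mono hM; apply: leq_addr.
Qed.

Section DualChain.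
Variables (P : nat -> lmodType R) (d : forall i, {linear P i.+1 -> P i}).
Hypotheses (fP : forall i, fg_projective (P i))
  (exP : forall i, exact_at (d i.+1) (d i)).

(* The image of P_(j+1)^* -> P_(j+2)^*.  Its dual is the image of P_(j+2) -> P_(j+1),
   and these modules form a D-chain. *)
Definition dual_image j : lmodType R^c := lquo (ker_submodule (transpose_map exP j)).

Definition dual_image_pi j : {linear ldual (P j.+1) -> dual_image j} :=
  lquo_pi (ker_submodule (transpose_map exP j)) \o transpose_pi d j.

Lemma dual_image_pi_epi j : epi (dual_image_pi j).
Proof.
move=> c; have [t <-] := lquo_pi_epi _ c.
by have [f <-] := @coker_pi_epi _ _ _ (lmap (d j)) t; exists f.
Qed.

Lemma dual_image_pi0 j f : dual_image_pi j f = 0 <-> lmap (d j.+1) f = 0.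
Proof. by rewrite -transpose_mapE; apply: lquo_pi0P. Qed.

Lemma dual_image_map_ex j : exists h : {linear dual_image j -> ldual (P j.+2)},
  forall f, h (dual_image_pi j f) = lmap (d j.+1) f.
Proof.
apply: coimage_lift; first exact: dual_image_pi_epi.
by move=> f /dual_image_pi0.
Qed.

Definition dual_image_map j := sval (cid (dual_image_map_ex j)).

Lemma dual_image_mapE j f : dual_image_map j (dual_image_pi j f) = lmap (d j.+1) f.
Proof. exact: (svalP (cid (dual_image_map_ex j))). Qed.

Lemma dual_image_map_inj j : injective (dual_image_map j).
Proof.
apply: linear_ker_inj => c; have [f <-] := dual_image_pi_epi c.
by rewrite dual_image_mapE => /dual_image_pi0.
Qed.

(** This epimorphism onto (dual_image j)^* has the kernel of d_(j+1) as its kernel, and its dual is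
    the double dual embedding of the D-chain. *)
Definition dual_image_rho_fun j (q : P j.+2) : rdual (dual_image j) :=
  leval q \o dual_image_map j : {linear dual_image j -> R^c^o}.

Lemma dual_image_rho_linear j : linear (@dual_image_rho_fun j).
Proof. by move=> r x y; apply: hom_ext => c; apply: (hom_funP (dual_image_map j c)). Qed.

Definition dual_image_rho j : {linear P j.+2 -> rdual (dual_image j)} :=
  mk_hom (@dual_image_rho_linear j).

Lemma dual_image_rhoE j q f :
  hom_fun (dual_image_rho j q) (dual_image_pi j f) = hom_fun f (d j.+1 q).
Proof. by rewrite -lmapE -dual_image_mapE. Qed.

Lemma dual_image_rho_epi j : epi (dual_image_rho j).
Proof.
move=> u; pose u' : {linear dual_image j -> R^c^o} := u.
have [q hq] := transpose_functional fP exP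
  (u' \o lquo_pi (ker_submodule (transpose_map exP j))).
exists q; apply: hom_ext => c; have [f <-] := dual_image_pi_epi c.
rewrite dual_image_rhoE -lmapE -transpose_mapE.
exact: esym (hq (transpose_pi d j f)).
Qed.

Lemma dual_image_rho0 j q : dual_image_rho j q = 0 <-> d j.+1 q = 0.
Proof.
split=> h.
  apply: (fg_projective_sep (fP j.+1)) => f.
  rewrite -[LHS]/(hom_fun (f : ldual _) (d j.+1 q)) -dual_image_rhoE h.
  exact: (erefl (0 : R)).
apply: hom_ext => c; have [f <-] := dual_image_pi_epi c.
rewrite dual_image_rhoE h; exact: (linear0 (f : {linear _ -> R^o})).
Qed.

Lemma dual_image_torsionless j : torsionless (dual_image j).
Proof.
move=> x y hxy; apply: dual_image_map_inj; apply: hom_ext => q.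
exact: (congr1 (fun s : ldual _ => hom_fun s (dual_image_rho j q)) hxy).
Qed.

Lemma dual_image_fin_gen j : fin_gen (dual_image j).
Proof.
apply: epi_fin_gen (@dual_image_pi_epi j) _.
exact/fg_projective_fin_gen/ldual_fg_projective.
Qed.

(** (dual_image j)^** consists of the functionals on P_(j+2) that vanish on ker d_(j+1) = im
    d_(j+2), that is, of the kernel of P_(j+2)^* -> P_(j+3)^*. *)
Lemma dual_image_step j : D_step (dual_image j) (dual_image j.+1).
Proof.
exists (ldual (P j.+2)), (lmap (dual_image_rho j)), (dual_image_pi j.+1); split.
- exact/fg_projective_fin_gen/ldual_fg_projective.
- exact/fg_projectiveP/ldual_fg_projective.
- split; last exact: dual_image_pi_epi.
    move=> f g fg; apply: hom_ext => u; have [q <-] := @dual_image_rho_epi j u.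
    exact: (congr1 (fun s : ldual _ => hom_fun s q) fg).
  move=> f; split=> [/dual_image_pi0 hf|[h <-]].
    have [|h hh] := @coimage_lift _ _ _ _ (dual_image_rho j) (f : {linear _ -> R^o})
      (@dual_image_rho_epi j).
      move=> q /dual_image_rho0/exP[x <-].
      by rewrite -[LHS]/(hom_fun (lmap (d j.+2) f) x) hf.
    by exists h; apply: hom_ext => q; apply: hh.
  apply/dual_image_pi0; apply: hom_ext => x; rewrite !lmapE.
  have -> : dual_image_rho j (d j.+2 x) = 0.
    by apply/dual_image_rho0; apply: (exact_comp0 (@exP j.+1)).
  exact: (linear0 (h : {linear _ -> R^o})).
- exists (P j.+2), (dual_image_rho j), idfun; split=> //.
  + exact: fg_projective_fin_gen.
  + exact: dual_image_rho_epi.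
  + by exists idfun.
Qed.

Lemma dual_image_D_class j : D_class j.+1 (dual_image j).
Proof.
split; first exact: dual_image_torsionless.
elim: j => [//|j IHj] /=; exists (dual_image j).
by split=> //; [apply: dual_image_fin_gen | apply: dual_image_step].
Qed.

Lemma dual_image_rdual_projective j :
  projective (coker (d j.+2)) -> projective (rdual (dual_image j)).
Proof.
move=> hC.
have [|s hs] := @coimage_lift _ _ _ _ (dual_image_rho j) (coker_pi (d j.+2))
  (@dual_image_rho_epi j).
  by move=> q /dual_image_rho0/exP[x <-]; apply/coker_exact; exists x.
have [|r hr] := @coker_lift _ _ _ _ (d j.+2) (dual_image_rho j).
  by move=> x; apply/dual_image_rho0; apply: (exact_comp0 (@exP j.+1)).
apply: (retract_projective (s := s) (r := r)) hC => u.
by have [q <-] := @dual_image_rho_epi j u; rewrite hs hr.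
Qed.

(** A section of the projection from P_(j+1)^* dualizes to a retraction of P_(j+1) onto (dual_image
    j)^*, which is the image of d_(j+1). *)
Lemma dual_image_projective_coker j :
  projective (dual_image j) -> projective (coker (d j.+1)).
Proof.
move=> hT; have [s hs] := hT _ _ (dual_image_pi j)
  (idfun : {linear dual_image j -> dual_image j}) (@dual_image_pi_epi j).
pose r_fun (x : P j.+1) : rdual (dual_image j) :=
  leval x \o s : {linear dual_image j -> R^c^o}.
have r_lin : linear r_fun.
  by move=> a x y; apply: hom_ext => c; apply: (hom_funP (s c)).
apply: ext_zero_coker (@exP j.+1) (fg_projectiveP (fP j.+1)) _ => f fd.
have [|h hh] := @coimage_lift _ _ _ _ (dual_image_rho j) f (@dual_image_rho_epi j).
  by move=> q /dual_image_rho0/exP[x <-].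
exists (h \o mk_hom r_lin) => q; rewrite -hh /=; congr (h _).
apply: hom_ext => c; have hsc : dual_image_pi j (s c) = c by apply: hs.
rewrite -[in LHS]hsc dual_image_rhoE; exact: (erefl (hom_fun (s c) (d j.+1 q))).
Qed.

(** The case k = 0, where D-class is no restriction. For K = coker (d 1), embedded in P_0, the
    cokernel N of P_0^* -> K^* has zero dual, so N is projective and therefore zero; the functionals
    of a dual basis of K then extend to P_0 and split the embedding. *)
Lemma coker_projective0 :
  (forall N : lmodType R^c, fin_gen N -> projective (rdual N : lmodType R) ->
     projective N) ->
  projective (coker (d 1)) -> projective (coker (d 0)).
Proof.
move=> H hK.
have [db dbi hdb] := coker_inj (@exP 0).
have fK : fg_projective (coker (d 1)).
  apply: projective_fg_projective hK.
  apply: epi_fin_gen (@coker_pi_epi _ _ _ (d 1)) _.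
  exact: fg_projective_fin_gen.
pose N := coker (lmap db).
have fN : fin_gen N.
  apply: epi_fin_gen (@coker_pi_epi _ _ _ (lmap db)) _.
  exact/fg_projective_fin_gen/ldual_fg_projective.
have N0 (u : {linear N -> R^c^o}) c : u c = 0.
  have [x hx] := ldual_reflexive (u \o coker_pi (lmap db)) fK.
  have x0 : x = 0.
    apply: dbi; rewrite linear0; apply: (fg_projective_sep (fP 0)) => f.
    rewrite -[LHS]/(hom_fun (lmap db f) x) -hx /=.
    by rewrite (exact_comp0 (@coker_exact _ _ _ (lmap db))) linear0.
  have [f <-] := @coker_pi_epi _ _ _ (lmap db) c.
  rewrite -[LHS]/((u \o coker_pi (lmap db)) f) hx x0.
  exact: (linear0 (f : {linear _ -> R^o})).
have hN : projective N.
  apply: H => //; apply: (retract_projective (s := \0) (r := \0)) (@zero_mod_projective R).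
  by move=> u; apply: hom_ext => c; rewrite -[RHS]/((u : {linear N -> R^c^o}) c) N0.
have Nz (c : N) : c = 0.
  by apply: (fg_projective_sep (projective_fg_projective fN hN)) => f; apply: N0.
have [n [x [phi hx]]] := fK.
have /choice[psi hpsi] a : exists f : ldual (P 0), lmap db f = phi a.
  by apply/coker_exact; apply: Nz.
have [g hg] : exists g : {linear P 0 -> coker (d 1)},
    forall p, g p = \sum_a (hom_fun (psi a) p : R) *: x a.
  apply: mk_linear => r p q; rewrite scaler_sumr -big_split.
  by apply: eq_bigr => i _; rewrite hom_funP scalerDl scalerA.
have gd c : g (db c) = c.
  rewrite hg [RHS]hx; apply: eq_bigr => a _.
  by rewrite -lmapE hpsi.
apply: ext_zero_coker (@exP 0) (fg_projectiveP (fP 0)) _ => f fd.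
have [fb hfb] := coker_lift fd.
by exists (fb \o g) => q; rewrite /= -hdb gd hfb.
Qed.

End DualChain.

Lemma D_class_findim k : noetherian R ->
  (forall N : lmodType R^c, fin_gen N -> D_class k N ->
     projective (rdual N : lmodType R) -> projective N) ->
  findim_le R k.
Proof.
move=> hR H M fM [n hM].
have [P fP] := noetherian_resolution hR fM.
have hP i : projective (P i) := fg_projectiveP (fP i).
apply: (coker_pdim (P := P)) => //; apply: (@projective_descent _ _ k n); last first.
  by apply: pdim_coker => //; apply: pdim_le_mono hM; apply: leq_addr.
move=> m km.
have main (X : nat -> lmodType R) (d : forall i, {linear X i.+1 -> X i}) :
    (forall i, fg_projective (X i)) -> (forall i, exact_at (d i.+1) (d i)) ->
    projective (coker (d k.+1)) -> projective (coker (d k)).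
  move=> fX exX hk; case: k H hk {km} => [|k] H hk.
    by apply: (coker_projective0 fX exX) => // N fN; apply: H.
  apply: (dual_image_projective_coker fX (exP := exX)); apply: H.
  - exact: dual_image_fin_gen.
  - exact: dual_image_D_class.
  - exact: dual_image_rdual_projective.
(* [main] treats degree k only; degree m is reached by dropping the first m - k terms of the
   resolution. *)
pose T j := projective (coker (res_d P j)).
have : T (k.+1 + (m - k))%N -> T (k + (m - k))%N.
  apply: (main (fun i => P (i + (m - k))%N) (fun i => res_d P (i + (m - k))%N)) => i.
    exact: fP.
  exact: res_exact.
by rewrite addSn subnKC.
Qed.

End FiniteProjectiveDimension.

(** * Reflexivity *)

Section Reflexivity.
Variable R : pzRingType.

Lemma inj_epi_bijective (S T : Type) (f : S -> T) : injective f -> epi f -> bijective f.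
Proof.
move=> fi fe; have /choice[g hg] := fe; exists g => // x.
exact/fi/hg.
Qed.

Definition sigma_map (N : lmodType R^c) : {linear N -> ldual (rdual N)} :=
  mk_hom (@sigma_linear R N).

Lemma sigma_mapE (N : lmodType R^c) x f : hom_fun (sigma_map N x) f = hom_fun f x.
Proof. by []. Qed.

Lemma rmap_inj (U V : lmodType R^c) (p : {linear U -> V}) : epi p -> injective (rmap p).
Proof.
move=> ep f g fg; apply: hom_ext => v; have [u <-] := ep v.
exact: (congr1 (fun h : rdual _ => hom_fun h u) fg).
Qed.

Lemma rmap_exact (U V W : lmodType R^c) (f : {linear U -> V}) (p : {linear V -> W}) :
  exact_at f p -> epi p -> exact_at (rmap p) (rmap f).
Proof.
move=> ex ep u; split=> [hu|[v <-]].
  have [|v hv] := @coimage_lift _ _ _ _ p (u : {linear _ -> R^c^o}) ep.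
    by move=> x /ex[y <-]; rewrite -[LHS]/(hom_fun (rmap f u) y) hu.
  by exists v; apply: hom_ext.
by apply: rmap_comp0; apply: exact_comp0.
Qed.

Lemma rdual_fin_gen (N : lmodType R^c) : noetherian R -> fin_gen N -> fin_gen (rdual N).
Proof.
move=> hR /fin_genP[n [p ep]].
have fF : fin_gen (rdual 'rV[R^c]_n).
  exact/fg_projective_fin_gen/rdual_fg_projective/rV_fg_projective.
have [m [f hf]] := noetherian_fin_gen hR fF (im_submodule (rmap p)).
have [|g hg] := @inj_lift _ _ _ _ (rmap p) f (rmap_inj ep).
  by move=> x; apply/hf; exists x.
apply/fin_genP; exists m, g => u.
have [x hx] : exists x, f x = rmap p u by apply/hf; exists u.
by exists x; apply: (rmap_inj ep); rewrite hg.
Qed.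

Lemma reflexive_projective (N : lmodType R^c) : noetherian R -> fin_gen N ->
  reflexive_module N -> projective (rdual N) -> projective N.
Proof.
move=> hR fN /= bN pN.
have si : injective (sigma_map N) by apply: bij_inj bN.
have [|r hr] := @inj_lift _ _ _ _ (sigma_map N)
    (idfun : {linear ldual (rdual N) -> ldual (rdual N)}) si.
  by move=> y; have [g _ gK] := bN; exists (g y); apply: gK.
apply: (retract_projective (s := sigma_map N) (r := r)).
  by move=> x; apply: si; apply: hr.
apply/fg_projectiveP/ldual_fg_projective/projective_fg_projective => //.
exact: rdual_fin_gen.
Qed.

Lemma exact_syzygy (A : pzRingType) (L : nat -> lmodType A)
    (delta : forall p, {linear L p -> L p.+1}) n i :
  (forall p, projective (L p)) ->
  (forall p, (i <= p < i + n)%N -> exact_at (delta p) (delta p.+1)) ->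
  syzygy n (coker (delta i)).
Proof.
move=> hL; elim: n i => [//|n IHn] i hex /=.
have [|j hj _] := @coker_short_exact _ _ _ _ (delta i) (delta i.+1).
  by apply: hex; rewrite leqnn addnS ltnS leq_addr.
exists (L i.+2), (coker (delta i.+1)), j, (coker_pi (delta i.+1)); split=> //.
apply: IHn => p /andP[ip pn]; apply: hex.
by rewrite (ltnW ip) addnS -addSn.
Qed.

(** Ext^1(C, R) = 0 lets [chi] extend from N^* to Q^*, and there it is evaluation at a point. *)
Lemma functional_extension_reflexive (N Q : lmodType R^c) (p : {linear Q -> N})
    (C : lmodType R) (c : {linear rdual Q -> C}) k :
  fg_projective Q -> idim_le k (R^o : lmodType R) -> short_exact (rmap p) c ->
  syzygy k C -> epi (@sigma R N).
Proof.
move=> fQ hk ip hC chi.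
have [g hg] := idim_syzygy_extend (chi : {linear rdual N -> R^o}) hk ip hC.
have [q hq] := rdual_reflexive g fQ.
by exists (p q); apply: hom_ext => f; rewrite -[RHS]hg hq.
Qed.

Lemma idim_reflexive k (N : lmodType R^c) :
  noetherian R^c -> idim_le k (R^o : lmodType R) -> fin_gen N ->
  reduced_grade_ge k.+1 N -> reflexive_module N.
Proof.
move=> hR hk fN gN; have [Q fQ] := noetherian_resolution hR fN.
pose L i : lmodType R := rdual (Q i); pose delta i := rmap (res_d Q i).
have pL i : projective (L i) by apply: rdual_projective.
have ex0 : exact_at (rmap (res_aug Q)) (delta 0).
  exact: rmap_exact (@res_exact0 _ _ Q) (@res_aug_epi _ _ Q).
have hex p : (p < k)%N -> exact_at (delta p) (delta p.+1).
  move=> pk u; split=> [hu|[v <-]]; last first.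
    by apply: rmap_comp0; apply: exact_comp0 (@res_exact _ _ Q p).
  have gp : Ext_vanishes p.+1 N (R^c^o : lmodType R^c) by apply: gN.
  have /ext_zero_rdual/(_ u hu)[v hv] := gp Q (fun i => fg_projectiveP (fQ i)).
  by exists v.
have sz : syzygy k (coker (delta 0)) by apply: exact_syzygy => // p /andP[_ /hex].
have [j hj jE] := coker_short_exact ex0.
apply: inj_epi_bijective; last first.
  apply: functional_extension_reflexive (fQ 0) hk _ _.
  - split; [|exact: coker_exact|exact: coker_pi_epi].
    exact: rmap_inj (@res_aug_epi _ _ Q).
  - apply: syzygyW; exists (L 1), (coker (delta 0)), j, (coker_pi (delta 0)).
    by split.
(* Evaluation at a lift [q] of [x] kills N^*, so it descends to the image of Q_0^* in Q_1^* and
   extends to Q_1^*. There it is evaluation at some [q1], whence q = d q1 and x = 0. *)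
suff si : injective (sigma_map N) by exact: si.
apply: linear_ker_inj => x hx; have [q qx] := res_aug_epi Q x.
have [|u hu] := @coker_lift _ _ _ _ (rmap (res_aug Q)) (reval q).
  move=> f; rewrite revalE rmapE qx -sigma_mapE hx; exact: (erefl (0 : R)).
have [g hg] := idim_syzygy_extend u hk hj sz.
have [q1 hq1] := rdual_reflexive g (fQ 1).
rewrite -qx; apply/res_exact0; exists q1.
apply/eqP; rewrite -subr_eq0; apply/eqP/(fg_projective_sep (fQ 0)) => f.
rewrite linearB; apply/eqP; rewrite subr_eq0; apply/eqP.
rewrite -[LHS]/(hom_fun (delta 0 f) q1) -hq1 -jE hg hu.
by [].
Qed.

Section Gorenstein.
Variables (I : coresolution (R^o : lmodType R)).
Hypotheses (lnoeth : noetherian R) (rnoeth : noetherian R^c)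
  (hI : forall i, injective_module (I i)) (fI : fdim_le 0 (I 0)).

(* Splice a resolution ... -> P_3 -> P_2 -> T^* with T^* -> P_1 -> P_0, where
   P_1 = Q_0^* and P_0 = Q_1^* for a presentation Q_1 -> Q_0 -> T.  Then
   T^** / sigma(T) is the kernel of P_2^* / P_1^* -> P_3^*, which has zero dual by
   [kernel_grade]. *)
Lemma bidual_functional (T : lmodType R^c) (phi : {linear ldual (rdual T) -> R^c^o}) :
  fin_gen T -> (forall x, phi (sigma_map T x) = 0) -> forall chi, phi chi = 0.
Proof.
move=> fT hphi; have [Q fQ] := noetherian_resolution rnoeth fT.
have [G fG] := noetherian_resolution lnoeth (rdual_fin_gen lnoeth fT).
have ex0 : exact_at (rmap (res_aug Q)) (rmap (res_d Q 0)).
  exact: rmap_exact (@res_exact0 _ _ Q) (@res_aug_epi _ _ Q).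
have ai : injective (rmap (res_aug Q)) := rmap_inj (@res_aug_epi _ _ Q).
pose P := ccons (rdual (Q 1)) (ccons (rdual (Q 0)) G).
pose d : forall i, {linear P i.+1 -> P i} :=
  ccons_d (rmap (res_d Q 0) : {linear ccons (rdual (Q 0)) G 0 -> _})
    (ccons_d (rmap (res_aug Q) \o res_aug G) (res_d G)).
have fP i : fg_projective (P i).
  apply: ccons_all; first exact: rdual_fg_projective.
  by apply: ccons_all => //; apply: rdual_fg_projective.
have exP i : exact_at (d i.+1) (d i).
  apply: ccons_exact => [f|].
    split=> [/ex0[t <-]|[g <-]].
      by have [g <-] := res_aug_epi G t; exists g.
    by apply/ex0; exists (res_aug G g).
  apply: ccons_exact => [g|j]; last exact: res_exact.
  split=> [h|[g' <-]].
    by apply/res_exact0/ai; rewrite linear0; apply: h.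
  have h0 : res_aug G (res_d G 0 g') = 0.
    by apply: (exact_comp0 (@res_exact0 _ _ G)).
  by rewrite -[LHS]/(rmap (res_aug Q) (res_aug G (res_d G 0 g'))) h0 linear0.
have [X fX] := noetherian_resolution rnoeth (transpose_fin_gen d fP 1).
have [S [dS [e [fS he S0 Sd]]]] := free_resolution rnoeth
  (noetherian_fin_gen rnoeth (transpose_fin_gen d fP 1)
    (ker_submodule (transpose_map exP 1))).
have fI0 i : (i <= 0)%N -> fdim_le i (I i) by case: i.
have H : ext_zero dS 0 (R^c^o : lmodType R^c).
  apply: (kernel_grade lnoeth hI fI0 fX fS S0 Sd _ (leqnn 0)) => //.
  move=> u s; have [q hq] := transpose_functional fP exP u; rewrite hq.
  by have -> : transpose_map exP 1 (e s) = 0 by apply/he; exists s.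
(* As Q_0^** is Q_0, what [th] kills lies in sigma(T); its image is the kernel of
   [transpose_map exP 1]. So [phi] induces a functional on that kernel, which is then zero. *)
pose th : {linear ldual (rdual T) -> transpose d 1} :=
  transpose_pi d 1 \o lmap (res_aug G).
have th_ker chi : th chi = 0 -> phi chi = 0.
  move=> /coker_exact[v hv].
  have [q hq] := rdual_reflexive (v : {linear rdual (Q 0) -> R^o}) (fQ 0).
  suff -> : chi = sigma_map T (res_aug Q q) by [].
  apply: hom_ext => t; have [g <-] := res_aug_epi G t.
  rewrite sigma_mapE -rmapE -hq -[LHS]/(hom_fun (lmap (res_aug G) chi) g) -hv.
  by [].
have th_im c : transpose_map exP 1 c = 0 -> exists chi, th chi = c.
  have [f <-] := @coker_pi_epi _ _ _ (lmap (d 1)) c.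
  rewrite transpose_mapE => hf.
  have [|chi hchi] := @coimage_lift _ _ _ _ (res_aug G) (f : {linear G 0 -> R^o})
      (@res_aug_epi _ _ G).
    move=> g /res_exact0[y <-].
    by rewrite -[LHS]/(hom_fun (lmap (d 2) f) y) hf.
  exists chi; rewrite /=; congr (transpose_pi d 1 _).
  exact: hom_ext.
have [f hf] : exists f : {linear S 0 -> R^c^o},
    forall s, exists chi, th chi = e s /\ f s = phi chi.
  apply: (@choose_linear _ _ _ (fun s y => exists chi, th chi = e s /\ y = phi chi)).
  - move=> s; have [|chi hchi] := th_im (e s); first by apply/he; exists s.
    by exists (phi chi), chi.
  - move=> s _ _ [chi [h ->]] [chi' [h' ->]]; apply/eqP; rewrite -subr_eq0.
    by rewrite -linearB; apply/eqP/th_ker; rewrite linearB h h' subrr.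
  - move=> a s s' _ _ [chi [h ->]] [chi' [h' ->]].
    by exists (a *: chi + chi'); rewrite !linearP h h'.
have f0 : forall s, f s = 0.
  apply: H => s; have [chi [h ->]] := hf (dS 0 s).
  by apply: th_ker; rewrite h (exact_comp0 S0).
move=> chi; have [s hs] : exists s, e s = th chi.
  apply/he; rewrite [th chi]/(transpose_pi d 1 _) transpose_mapE.
  by apply: lmap_comp0; apply: (exact_comp0 (@res_exact0 _ _ G)).
have [chi' [h h']] := hf s.
have : phi (chi - chi') = 0 by apply: th_ker; rewrite linearB h hs subrr.
by rewrite linearB -h' f0 subr0.
Qed.

(** Surjectivity onto T^* is where the double dual embedding enters: an element of T^* is rho y for
    some y, and evaluation at y, a functional on P = Y^*, restricts to it. *)
Lemma D_step_short_exact (T T' : lmodType R^c) : fin_gen T -> D_step T T' ->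
  exists (P : lmodType R^c) (p : {linear P -> T'})
         (c : {linear rdual P -> rdual T}),
    [/\ fg_projective P, epi p & short_exact (rmap p) c].
Proof.
move=> fT [P [i [p [fP pP [ii ex ep] [Y [rho [theta [fY erho bth hi]]]]]]]].
exists P, p, (rmap (i \o sigma_map T)); split=> //.
  exact: projective_fg_projective.
split; first exact: rmap_inj.
  move=> u; split=> [hu|[v <-]]; last first.
    by apply: rmap_comp0 => x; apply: (exact_comp0 ex).
  apply/(rmap_exact ex ep); apply: hom_ext => chi.
  pose u' : {linear P -> R^c^o} := u.
  apply: (@bidual_functional T (u' \o i) fT) => x.
  by rewrite -[LHS]/(hom_fun (rmap (i \o sigma_map T) u) x) hu.
move=> t; have [y hy] := erho t.
have thi : injective theta := bij_inj bth.
have [|g hg] := @inj_lift _ _ _ _ theta (idfun : {linear P -> P}) thi.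
  by move=> x; have [h _ hK] := bth; exists (h x); apply: hK.
exists (leval y \o g : {linear P -> R^c^o}); apply: hom_ext => x.
rewrite rmapE -[LHS]/(hom_fun (g (i (sigma_map T x))) y).
have -> : g (i (sigma_map T x)) = dual_map rho (sigma_map T x).
  by apply: thi; rewrite hg hi.
by rewrite -hy.
Qed.

(** The presentation of the first module of the chain gives one embedding into a projective and each
    of the n steps adds one, so D-class n + 1 yields an (n+1)-st syzygy. *)
Lemma D_chain_syzygy n (T : lmodType R^c) : fin_gen T -> D_chain n T ->
  exists (P : lmodType R^c) (p : {linear P -> T}) (C : lmodType R)
         (c : {linear rdual P -> C}),
    [/\ fg_projective P, epi p, short_exact (rmap p) c & syzygy n.+1 C].
Proof.
elim: n T => [|n IHn] T fT.
  move=> _; have [Q fQ] := noetherian_resolution rnoeth fT.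
  have ex0 := rmap_exact (@res_exact0 _ _ Q) (@res_aug_epi _ _ Q).
  have [j hj _] := coker_short_exact ex0.
  exists (Q 0), (res_aug Q), _, (coker_pi (rmap (res_aug Q))); split=> //.
  - exact: res_aug_epi.
  - split; [|exact: coker_exact|exact: coker_pi_epi].
    exact: rmap_inj (@res_aug_epi _ _ Q).
  exists (rdual (Q 1)), _, j, (coker_pi (rmap (res_d Q 0))); split=> //.
  exact: rdual_projective.
move=> [T0 [fT0 cT0 sT0]].
have [P [p [c [fP ep ec]]]] := D_step_short_exact fT0 sT0.
have [P0 [p0 [C0 [c0 [fP0 ep0 ec0 hC0]]]]] := IHn _ fT0 cT0.
exists P, p, (rdual T0), c; split=> //.
exists (rdual P0), C0, (rmap p0), c0; split=> //.
exact: rdual_projective.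
Qed.

Lemma idim_D_class_reflexive k (N : lmodType R^c) :
  idim_le k (R^o : lmodType R) -> fin_gen N -> D_class k N -> reflexive_module N.
Proof.
case: k => [|k] hk fN hN.
  (* For k = 0 both D-class 0 and reduced grade at least 1 hold for every module. *)
  by apply: (idim_reflexive rnoeth hk fN); case.
have [tN cN] := hN.
have [P [p [C [c [fP ep ec hC]]]]] := D_chain_syzygy fN cN.
apply: inj_epi_bijective => //.
exact: functional_extension_reflexive fP hk ec hC.
Qed.

End Gorenstein.
End Reflexivity.

Theorem theorem2p16 (k : nat) (R : pzRingType)
    (lnoeth : left_noetherian R) (rnoeth : left_noetherian R^c)
    (gor : n_gorenstein R k.+1) :
  [<-> idim_le k (R^o : lmodType R);
       Findim_le R k;
       findim_le R k;
       (forall N : lmodType R^c, fin_gen N ->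
          reduced_grade_ge k.+1 N -> reflexive_module N);
       (forall N : lmodType R^c, fin_gen N ->
          reduced_grade_ge k.+1 N -> torsionless N);
       (forall N : lmodType R^c, fin_gen N ->
          D_class k N -> reflexive_module N);
       (forall N : lmodType R^c, fin_gen N ->
          D_class k N -> projective (rdual N : lmodType R) ->
          projective N)].
Proof.
have hR := left_noetherianP lnoeth; have hRc := left_noetherianP rnoeth.
have [I [[hI _ _] fdI]] := gor.
have fdI' i : (i <= k)%N -> fdim_le i (I i) by exact: fdI.
have idim_of (H : forall (X : nat -> lmodType R) (d : forall i, {linear X i.+1 -> X i}),
    (forall i, fg_projective (X i)) -> (forall i, exact_at (d i.+1) (d i)) ->
    ext_zero d k.+1 (R^o : lmodType R)) : idim_le k (R^o : lmodType R).
  apply: (idim_of_ext hR hI) => X d; apply: H.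
have of_findim : findim_le R k -> idim_le k (R^o : lmodType R).
  move=> fk; apply: idim_of => X d fX exX.
  exact: (findim_ext fX exX hR hRc hI fdI' fk).
have of_torsionless : (forall N : lmodType R^c, fin_gen N ->
    reduced_grade_ge k.+1 N -> torsionless N) -> idim_le k (R^o : lmodType R).
  move=> tl; apply: idim_of => X d fX exX.
  apply: (torsionless_transpose_ext fX exX); apply: tl.
    exact: transpose_fin_gen.
  exact: (transpose_reduced_grade fX exX hR hRc hI fdI').
(* In the cycle of implications, (3) => (4) and (5) => (6) pass through (1), and (7) => (1) passes
   through (3). *)
tfae.
- exact: idim_Findim.
- by move=> h M _; apply: h.
- by move=> /of_findim h N; apply: idim_reflexive.
- by move=> h N fN gN; apply: bij_inj (h N fN gN).
- by move=> /of_torsionless h N; apply: (idim_D_class_reflexive hR hRc hI (fdI' 0 isT)).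
- by move=> h N fN dN; apply: reflexive_projective => //; apply: h.
- by move=> h; apply/of_findim/D_class_findim.
Qed.
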